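(* Let $g\in B_4$ be a non-identity braid and write $g=\Delta^{k}\sigma$ for the Garside normal form of $g$. Let $t\neq 2$ be a prime number and let $a,b$ be coprime integers such that $b\neq 0$ has a prime factor distinct from $2$. If either $k\geq 0$ or $\sigma$ is a normal braid, then $g\notin\ker((\beta_4)_t)$, and in particular, $g\notin\ker(\beta_4)$. If $\sigma$ is a normal braid, then $g\notin\ker\left(\beta_4|_{q=\frac{a}{b}}\right)$.
   Context: $B_4=\langle \sigma_1,\sigma_2,\sigma_3 : \sigma_1\sigma_2\sigma_1=\sigma_2\sigma_1\sigma_2,\ \sigma_2\sigma_3\sigma_2=\sigma_3\sigma_2\sigma_3,\ \sigma_1\sigma_3=\sigma_3\sigma_1\rangle$ is the braid group on four strands. The (reduced) Burau representation $\beta_4:B_4\to \mathrm{GL}_3(\mathbb{Z}[q^{\pm1}])$ is the homomorphism with $$\sigma_1\mapsto\begin{pmatrix} q&0&0\\-q&1&0\\0&0&1\end{pmatrix},\quad \sigma_2\mapsto\begin{pmatrix}1&1&0\\0&q&0\\0&-q&1\end{pmatrix},\quad \sigma_3\mapsto\begin{pmatrix}1&0&0\\0&1&1\\0&0&q\end{pmatrix}.$$ For a prime $t$, $(\beta_4)_t:B_4\to\mathrm{GL}_3((\mathbb{Z}/t\mathbb{Z})[q^{\pm1}])$ is the reduction of $\beta_4$ modulo $t$. For a rational number $\frac{a}{b}$, $\beta_4|_{q=\frac ab}:B_4\to\mathrm{GL}_3(\mathbb{Q})$ is the specialization of $\beta_4$ at $q=\frac ab$ (note that the hypotheses on $a,b$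 force $a\neq0$). The Garside element is $\Delta=(\sigma_1\sigma_2\sigma_3)(\sigma_1\sigma_2)\sigma_1$. A positive braid is an element of the submonoid of $B_4$ generated by $\sigma_1,\sigma_2,\sigma_3$. Every $g\in B_4$ can be written uniquely as $g=\Delta^k\sigma$ with $k\in\mathbb{Z}$ and $\sigma$ a positive braid such that $\sigma\neq\Delta\tau$ for every positive braid $\tau$ (equivalently, $k$ is as large as possible); this expression is the Garside normal form of $g$. A product expansion of a positive braid $\sigma$ is an expression of $\sigma$ as a word in $\sigma_1,\sigma_2,\sigma_3$ (positive powers only; words are read from left to right; all expansions of $\sigma$ have the same length). The minimal form of $\sigma$ is the product expansion whose sequence of generator indices, read from left to right, is lexicographically minimal among all product expansions of $\sigma$. It is written $\sigma=\prod_{i=1}^n\sigma_1^{a_i}\sigma_3^{b_i}\sigma_2^{c_i}$ with $a_i,b_i,c_i\geq 0$, where $a_i+b_i>0$ for $2\leq i\leq n$ and $c_i>0$ for $1\leq i\leq n-1$. The positive braid $\sigma$, with minimal form $\sigma=\prod_{i=1}^n\sigma_1^{a_i}\sigma_3^{b_i}\sigma_2^{c_i}$ (where $a_i,b_i,c_i\geq 0$, $a_i+b_i>0$ for $2\leq i\leq n$ and $c_i>0$ for $1\leq i\leq n-1$), is a normal braid if the following hold for each $p<n$ (a clause involving the index $p-1$ is imposed only when $p\geq 2$): (i) If $a_p=0$ and $b_p=1$, then $c_p\neq 1,2$. If $a_p=0$, $b_p=1$ and $a_{p-1}+1\geq c_p$, then $c_{p-1}\neq 1$. (ii) If $b_p>0$,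 $a_p\geq b_p+1$ and $c_p=1$, then $a_{p+1}\neq 2$. If $a_p=1$, $b_p=1$ and $c_p=1$, then $a_{p+1}\neq 2$. *)

(* Defs.v *)
From HB Require Import structures.
From mathcomp Require Import all_boot all_order all_algebra.
From mathcomp Require Import boolp.
From mathcomp Require Import ring.

Set Implicit Arguments.
Unset Strict Implicit.
Unset Printing Implicit Defensive.

Import Order.TTheory GRing.Theory Num.Theory.
Local Open Scope group_scope.

(* The index i : 'I_3 stands for the generator sigma_(i+1). *)
Definition i1 : 'I_3 := @Ordinal 3 0 isT.
Definition i2 : 'I_3 := @Ordinal 3 1 isT.
Definition i3 : 'I_3 := @Ordinal 3 2 isT.

(* Group words: (false, i) is the letter sigma_i, (true, i) its inverse. *)
Definition letter : Type := (bool * 'I_3)%type.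
Definition flip (x : letter) : letter := (~~ x.1, x.2).
Definition pos (w : seq 'I_3) : seq letter := [seq (false, i) | i <- w].

Inductive braid_rel : seq letter -> seq letter -> Prop :=
| BraidRefl w : braid_rel w w
| BraidSym w w' : braid_rel w w' -> braid_rel w' w
| BraidTrans w w' w'' : braid_rel w w' -> braid_rel w' w'' -> braid_rel w w''
| BraidCat u u' w w' :
    braid_rel u u' -> braid_rel w w' -> braid_rel (u ++ w) (u' ++ w')
| BraidInv x : braid_rel [:: x; flip x] [::]
| Braid121 : braid_rel (pos [:: i1; i2; i1]) (pos [:: i2; i1; i2])
| Braid232 : braid_rel (pos [:: i2; i3; i2]) (pos [:: i3; i2; i3])
| Braid13 : braid_rel (pos [:: i1; i3]) (pos [:: i3; i1]).

Definition braid_eq : rel (seq letter) := fun w w' => `[< braid_rel w w' >].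

Lemma braid_eqP w w' : reflect (braid_rel w w') (braid_eq w w').
Proof. exact: asboolP. Qed.

Lemma braid_eq_refl : reflexive braid_eq.
Proof. by move=> w; apply/braid_eqP/BraidRefl. Qed.
Lemma braid_eq_sym : symmetric braid_eq.
Proof. by move=> w w'; apply/braid_eqP/braid_eqP; apply: BraidSym. Qed.
Lemma braid_eq_trans : transitive braid_eq.
Proof.
move=> w' w w'' /braid_eqP h /braid_eqP h'.
exact/braid_eqP/(BraidTrans h h').
Qed.

Canonical braid_equiv :=
  EquivRel braid_eq braid_eq_refl braid_eq_sym braid_eq_trans.

Definition B4 : Type := {eq_quot braid_eq}%qT.
HB.instance Definition _ := Choice.on B4.
HB.instance Definition _ := EqQuotient.on B4.

Definition braid_of (w : seq letter) : B4 := \pi_B4%qT w.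

Lemma braid_of_eq w w' : braid_of w = braid_of w' <-> braid_rel w w'.
Proof.
split; first by move=> /eqmodP /braid_eqP.
by move=> /braid_eqP h; apply/eqmodP.
Qed.

Lemma braid_reprK (g : B4) : braid_of (repr g)%qT = g.
Proof. exact: reprK. Qed.

Lemma repr_braid_of w : braid_rel (repr (braid_of w))%qT w.
Proof. by apply/braid_of_eq; rewrite braid_reprK. Qed.

Definition inv_word (w : seq letter) : seq letter := rev (map flip w).

Lemma flipK : involutive flip. Proof. by case=> b i; rewrite /flip /= negbK. Qed.

Lemma inv_wordK : involutive inv_word.
Proof. by move=> w; rewrite /inv_word map_rev revK mapK //; apply: flipK. Qed.

Lemma cat_inv_word w : braid_rel (w ++ inv_word w) [::].
Proof.
elim: w => [|x w IH]; first exact: BraidRefl.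
rewrite (_ : _ ++ _ = [:: x] ++ (w ++ inv_word w) ++ [:: flip x]); last first.
  by rewrite /inv_word /= rev_cons -cats1 catA.
apply: (BraidTrans (w' := [:: x] ++ [::] ++ [:: flip x])); last exact: BraidInv.
apply: BraidCat; first exact: BraidRefl.
by apply: BraidCat; [exact: IH | exact: BraidRefl].
Qed.

Lemma inv_word_cat w : braid_rel (inv_word w ++ w) [::].
Proof. by rewrite -{2}[w]inv_wordK; apply: cat_inv_word. Qed.

Definition B4_one : B4 := braid_of [::].
Definition B4_mul (g h : B4) : B4 := braid_of (repr g ++ repr h)%qT.
Definition B4_inv (g : B4) : B4 := braid_of (inv_word (repr g)%qT).

Lemma braid_of_cat w w' : braid_of (w ++ w') = B4_mul (braid_of w) (braid_of w').
Proof. by apply/braid_of_eq/BraidSym/BraidCat; apply: repr_braid_of. Qed.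

Lemma B4_mulA : associative B4_mul.
Proof.
move=> g h k; rewrite -[g]braid_reprK -[h]braid_reprK -[k]braid_reprK.
by rewrite -!braid_of_cat catA.
Qed.
Lemma B4_mul1 : left_id B4_one B4_mul.
Proof. by move=> g; rewrite -[g]braid_reprK -braid_of_cat. Qed.
Lemma B4_mulr1 : right_id B4_one B4_mul.
Proof. by move=> g; rewrite -[g]braid_reprK -braid_of_cat cats0. Qed.
Lemma B4_mulV : left_inverse B4_one B4_inv B4_mul.
Proof.
move=> g; rewrite -{2}[g]braid_reprK -braid_of_cat.
exact/braid_of_eq/inv_word_cat.
Qed.
Lemma B4_mulrV : right_inverse B4_one B4_inv B4_mul.
Proof.
move=> g; rewrite -{1}[g]braid_reprK -braid_of_cat.
exact/braid_of_eq/cat_inv_word.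
Qed.

HB.instance Definition _ :=
  isGroup.Build B4 B4_mulA B4_mul1 B4_mulr1 B4_mulV B4_mulrV.

Definition sigma (i : 'I_3) : B4 := braid_of [:: (false, i)].

(* The map B4 -> G induced by f; a morphism when f satisfies the relations. *)
Definition eval_word (G : groupType) (f : 'I_3 -> G) (w : seq letter) : G :=
  \prod_(x <- w) (if x.1 then (f x.2)^-1 else f x.2).
Definition braid_lift (G : groupType) (f : 'I_3 -> G) (g : B4) : G :=
  eval_word f (repr g)%qT.

Section Lift.
Variables (G : groupType) (f : 'I_3 -> G).
Hypothesis f121 : f i1 * f i2 * f i1 = f i2 * f i1 * f i2.
Hypothesis f232 : f i2 * f i3 * f i2 = f i3 * f i2 * f i3.
Hypothesis f13 : f i1 * f i3 = f i3 * f i1.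

Lemma eval_word_cat w w' : eval_word f (w ++ w') = eval_word f w * eval_word f w'.
Proof. by rewrite /eval_word big_cat. Qed.

Lemma eval_word_rel w w' : braid_rel w w' -> eval_word f w = eval_word f w'.
Proof.
elim=> {w w'} //=.
- by move=> w w' w'' _ -> _ ->.
- by move=> u u' w w' _ hu _ hw; rewrite !eval_word_cat hu hw.
- case=> [[] i]; rewrite /eval_word !big_cons !big_nil mulg1 /=.
    exact: mulVg.
  exact: mulgV.
- by rewrite /eval_word !big_cons !big_nil /= !mulg1 !mulgA.
- by rewrite /eval_word !big_cons !big_nil /= !mulg1 !mulgA.
- by rewrite /eval_word !big_cons !big_nil /= !mulg1.
Qed.

Lemma braid_lift_sigma i : braid_lift f (sigma i) = f i.
Proof.
rewrite /braid_lift (eval_word_rel (repr_braid_of _)).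
by rewrite /eval_word big_seq1.
Qed.

Lemma braid_lift_mul : {morph braid_lift f : g h / g * h}.
Proof.
move=> g h; rewrite /braid_lift -eval_word_cat.
exact/eval_word_rel/repr_braid_of.
Qed.
End Lift.

Local Open Scope ring_scope.

(* GL_n(R) as a (possibly infinite) group. *)
Section GL.
Variables (n : nat) (R : comUnitRingType).
Record GL := MkGL { GLmx :> 'M[R]_n; _ : GLmx \in unitmx }.
HB.instance Definition _ := [isSub for GLmx].
HB.instance Definition _ := [Choice of GL by <:].

Lemma GL_unit (A : GL) : (A : 'M[R]_n) \in unitmx. Proof. by case: A. Qed.
Lemma GL_mul_subproof (A B : GL) : A *m B \in unitmx.
Proof. by rewrite unitmx_mul !GL_unit. Qed.
Lemma GL_inv_subproof (A : GL) : invmx A \in unitmx.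
Proof. by rewrite unitmx_inv GL_unit. Qed.

Definition GL_one := MkGL (unitmx1 R n).
Definition GL_mul A B := MkGL (GL_mul_subproof A B).
Definition GL_inv A := MkGL (GL_inv_subproof A).

Lemma GL_mulA : associative GL_mul.
Proof. by move=> A B C; apply: val_inj; rewrite /= mulmxA. Qed.
Lemma GL_mul1 : left_id GL_one GL_mul.
Proof. by move=> A; apply: val_inj; rewrite /= mul1mx. Qed.
Lemma GL_mulr1 : right_id GL_one GL_mul.
Proof. by move=> A; apply: val_inj; rewrite /= mulmx1. Qed.
Lemma GL_mulV : left_inverse GL_one GL_inv GL_mul.
Proof. by move=> A; apply: val_inj; rewrite /= mulVmx ?GL_unit. Qed.
Lemma GL_mulrV : right_inverse GL_one GL_inv GL_mul.
Proof. by move=> A; apply: val_inj; rewrite /= mulmxV ?GL_unit. Qed.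
HB.instance Definition _ :=
  isGroup.Build GL GL_mulA GL_mul1 GL_mulr1 GL_mulV GL_mulrV.

Lemma GLmx1 : GLmx 1%g = 1%:M. Proof. by []. Qed.
Lemma GLmxM A B : GLmx (A * B)%g = A *m B. Proof. by []. Qed.
Lemma GLmxV A : GLmx A^-1%g = invmx A. Proof. by []. Qed.
End GL.

(* The Laurent polynomials R[q, 1/q] over a domain R, as the subring of
   Frac(R[X]) made of the fractions p / X^n. *)
Section Laurent.
Variable R : idomainType.
Local Notation K := {fraction {poly R}}.
Local Notation tofrac := (@FracField.tofrac {poly R}).

Definition laurent_pred : {pred K} :=
  fun x => `[< exists (p : {poly R}) (n : nat), x = tofrac p / tofrac 'X ^+ n >].

Record laurent := MkLaurent { laurent_val :> K; _ : laurent_val \in laurent_pred }.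
HB.instance Definition _ := [isSub for laurent_val].
HB.instance Definition _ := [Choice of laurent by <:].

Lemma laurentX_neq0 n : tofrac 'X ^+ n != 0.
Proof. by rewrite expf_neq0 // tofrac_eq0 polyX_eq0. Qed.

Lemma laurent_subring : subring_closed laurent_pred.
Proof.
split.
- by apply/asboolP; exists 1, 0%N; rewrite rmorph1 expr0 divr1.
- move=> x y /asboolP[p [m ->]] /asboolP[r [n ->]]; apply/asboolP.
  exists (p * 'X^n - r * 'X^m), (m + n)%N.
  rewrite -mulNr addf_div ?laurentX_neq0 // mulNr -exprD.
  by rewrite rmorphB !rmorphM !rmorphXn.
- move=> x y /asboolP[p [m ->]] /asboolP[r [n ->]]; apply/asboolP.
  by exists (p * r), (m + n)%N; rewrite mulf_div rmorphM exprD.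
Qed.
HB.instance Definition _ :=
  GRing.isSubringClosed.Build K laurent_pred laurent_subring.
HB.instance Definition _ := [SubChoice_isSubComNzRing of laurent by <:].

Definition laurent_unit : pred laurent :=
  fun x => (val x != 0) && ((val x)^-1 \in laurent_pred).
Definition laurent_inv (x : laurent) : laurent :=
  if laurent_unit x then insubd x (val x)^-1 else x.

Lemma laurent_mulV : {in laurent_unit, left_inverse 1 laurent_inv *%R}.
Proof.
move=> x xU; apply: val_inj.
have xU' : laurent_unit x by [].
have /andP[x0 xV] := xU'.
by rewrite rmorphM /laurent_inv xU' /= insubdK // mulVf.
Qed.
Lemma laurent_unitP (x y : laurent) : y * x = 1 -> laurent_unit x.
Proof.
move=> /(congr1 val); rewrite rmorphM rmorph1 => yx1.
have x0 : val x != 0.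
  apply/eqP => x0; move: yx1; rewrite /= in x0 *; rewrite x0 mulr0 => /eqP.
  by rewrite eq_sym oner_eq0.
rewrite /laurent_unit x0 /=.
by rewrite -[_^-1]mul1r -yx1 mulfK //; case: (y).
Qed.
Lemma laurent_inv_out : {in [predC laurent_unit], laurent_inv =1 id}.
Proof.
move=> x xN; have /negbTE xN' : ~~ laurent_unit x by [].
by rewrite /laurent_inv xN'.
Qed.
HB.instance Definition _ := GRing.ComNzRing_hasMulInverse.Build laurent
  laurent_mulV laurent_unitP laurent_inv_out.

Lemma laurentq_subproof : tofrac 'X \in laurent_pred.
Proof. by apply/asboolP; exists 'X, 0%N; rewrite expr0 divr1. Qed.
Definition laurentq : laurent := MkLaurent laurentq_subproof.

Lemma laurentq_unit : laurentq \is a GRing.unit.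
Proof.
have X0 := laurentX_neq0 1; rewrite expr1 in X0.
rewrite unfold_in /= /laurent_unit /= X0 /=.
by apply/asboolP; exists 1, 1%N; rewrite rmorph1 expr1 mul1r.
Qed.
End Laurent.

(* The ring morphism R[q, 1/q] -> S given by f : R -> S on coefficients and
   sending q to the unit u. *)
Section LaurentEval.
Variables (R : idomainType) (S : comUnitRingType) (f : {rmorphism R -> S}).
Variables (u : S) (uU : u \is a GRing.unit).
Local Notation tofrac := (@FracField.tofrac {poly R}).
Local Notation ev := (fun p : {poly R} => (map_poly f p).[u]).

Lemma laurentP (x : laurent R) :
  exists pn : {poly R} * nat, val x = tofrac pn.1 / tofrac 'X ^+ pn.2.
Proof. by case: x => x /= /asboolP[p [n ->]]; exists (p, n). Qed.

Definition laurent_eval of u \is a GRing.unit := fun x : laurent R =>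
  let pn := projT1 (cid (laurentP x)) in ev pn.1 / u ^+ pn.2.

Lemma laurent_evalE (x : laurent R) p n :
  val x = tofrac p / tofrac 'X ^+ n -> laurent_eval uU x = ev p / u ^+ n.
Proof.
rewrite /laurent_eval; case: cid => -[r m] /= -> /eqP.
rewrite eqr_div ?laurentX_neq0 // -!rmorphXn -!rmorphM tofrac_eq => /eqP rp.
have /(congr1 ev) := rp; rewrite /= !rmorphM /= !hornerM !map_polyXn !hornerXn => erp.
apply: (canLR (mulrK (unitrX m uU))); rewrite mulrAC.
by apply: (canRL (mulrK (unitrX n uU))).
Qed.

Lemma laurent_eval_is_zmod_morphism : zmod_morphism (laurent_eval uU).
Proof.
move=> x y; have [[p m] /= xE] := laurentP x; have [[r n] /= yE] := laurentP y.
rewrite (laurent_evalE xE) (laurent_evalE yE).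
rewrite (@laurent_evalE _ (p * 'X^n - r * 'X^m) (m + n)%N); last first.
  rewrite rmorphB /= xE yE -mulNr addf_div ?laurentX_neq0 // mulNr -exprD.
  by rewrite rmorphB !rmorphM !rmorphXn.
rewrite rmorphB !rmorphM /= !hornerE !map_polyXn !hornerXn.
apply: (canLR (mulrK (unitrX _ uU))); rewrite exprD mulrBl.
by rewrite mulrA mulrVK ?unitrX // (mulrC (u ^+ m)) mulrA mulrVK ?unitrX.
Qed.

Lemma laurent_eval_is_monoid_morphism : GRing.monoid_morphism (laurent_eval uU).
Proof.
split.
  rewrite (@laurent_evalE _ 1 0); last by rewrite !rmorph1 expr0 divr1.
  by rewrite rmorph1 hornerC expr0 divr1.
move=> x y; have [[p m] /= xE] := laurentP x; have [[r n] /= yE] := laurentP y.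
rewrite (laurent_evalE xE) (laurent_evalE yE).
rewrite (@laurent_evalE _ (p * r) (m + n)%N); last first.
  by rewrite rmorphM /= xE yE mulf_div rmorphM exprD.
rewrite rmorphM /= hornerM exprD; apply: (canLR (mulrK _)).
  by rewrite unitrM !unitrX.
by rewrite mulrACA !mulrVK ?unitrX //.
Qed.

HB.instance Definition _ := GRing.isZmodMorphism.Build (laurent R) S
  (laurent_eval uU) laurent_eval_is_zmod_morphism.
HB.instance Definition _ := GRing.isMonoidMorphism.Build (laurent R) S
  (laurent_eval uU) laurent_eval_is_monoid_morphism.

Lemma laurent_eval_q : laurent_eval uU (laurentq R) = u.
Proof.
rewrite (@laurent_evalE _ 'X 0); last by rewrite expr0 divr1.
by rewrite map_polyX hornerX expr0 divr1.
Qed.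
End LaurentEval.

Definition mx3 (R : pzRingType) (s : seq (seq R)) : 'M[R]_3 :=
  \matrix_(i, j) (nth [::] s i)`_j.

Definition burau_mx (R : pzRingType) (q : R) (i : 'I_3) : 'M[R]_3 :=
  match val i with
  | 0 => mx3 [:: [:: q; 0; 0]; [:: - q; 1; 0]; [:: 0; 0; 1]]
  | 1 => mx3 [:: [:: 1; 1; 0]; [:: 0; q; 0]; [:: 0; - q; 1]]
  | _ => mx3 [:: [:: 1; 0; 0]; [:: 0; 1; 1]; [:: 0; 0; q]]
  end.

Section Burau.
Variables (R : comUnitRingType) (q : R).

(* For a non-unit q, where these matrices are not invertible, the value is
   the junk 1; only units are used. *)
Definition burau_gen (i : 'I_3) : GL 3 R := insubd (1%g : GL 3 R) (burau_mx q i).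

Lemma det_burau_mx i : \det (burau_mx q i) = q.
Proof.
rewrite (expand_det_row _ ord0) !big_ord_recl big_ord0 /cofactor.
rewrite !(expand_det_row _ ord0) !big_ord_recl !big_ord0 /cofactor !det_mx11.
case: i => -[|[|[|//]]] ?; rewrite /burau_mx !mxE /=.
- by ring.
- by ring.
- by ring.
Qed.

Lemma burau_genE i : q \is a GRing.unit -> burau_gen i = burau_mx q i :> 'M_3.
Proof.
move=> qU; have mU : burau_mx q i \in unitmx by rewrite unitmxE det_burau_mx.
exact: (insubdK (1%g : GL 3 R) mU).
Qed.

Lemma burau_gen_junk i : q \isn't a GRing.unit -> burau_gen i = 1%g.
Proof.
by move=> qN; rewrite /burau_gen /insubd insubN // unitmxE det_burau_mx.
Qed.

Local Ltac burau_rel :=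
  case: (boolP (q \is a GRing.unit)) => qU; last (by rewrite !burau_gen_junk);
  apply: val_inj; rewrite /= !burau_genE //; apply/matrixP;
  case=> -[|[|[|//]]] ?; case=> -[|[|[|//]]] ?;
  rewrite !mxE !big_ord_recl !big_ord0 !mxE ?big_ord_recl ?big_ord0 ?mxE /=;
  ring.

Lemma burau121 : (burau_gen i1 * burau_gen i2 * burau_gen i1
                = burau_gen i2 * burau_gen i1 * burau_gen i2)%g.
Proof. burau_rel. Qed.

Lemma burau232 : (burau_gen i2 * burau_gen i3 * burau_gen i2
                = burau_gen i3 * burau_gen i2 * burau_gen i3)%g.
Proof. burau_rel. Qed.
Lemma burau13 : (burau_gen i1 * burau_gen i3 = burau_gen i3 * burau_gen i1)%g.
Proof. burau_rel. Qed.

Definition burau : B4 -> GL 3 R := braid_lift burau_gen.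

Lemma burau_monoid_morphism : monoid.monoid_morphism burau.
Proof.
have bM := braid_lift_mul burau121 burau232 burau13.
split=> //; rewrite /burau /braid_lift.
rewrite (eval_word_rel burau121 burau232 burau13 (repr_braid_of [::])).
exact: big_nil.
Qed.
HB.instance Definition _ :=
  isUMagmaMorphism.Build B4 (GL 3 R) burau burau_monoid_morphism.

Lemma burau_sigma i :
  q \is a GRing.unit -> burau (sigma i) = burau_mx q i :> 'M_3.
Proof.
by move=> qU; rewrite /burau braid_lift_sigma ?burau_genE //;
  [exact: burau121 | exact: burau232 | exact: burau13].
Qed.
End Burau.

Lemma burau_map (R S : comUnitRingType) (f : {rmorphism R -> S}) (q : R) g :
  q \is a GRing.unit -> burau (f q) g = map_mx f (burau q g) :> 'M_3.
Proof.
move=> qU; have fqU : f q \is a GRing.unit by apply: rmorph_unit.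
have E i : burau_gen (f q) i = map_mx f (burau_gen q i) :> 'M_3.
  rewrite !burau_genE //; apply/matrixP => j k.
  case: i => -[|[|[|//]]] ?; rewrite /burau_mx /= !mxE;
  case: j => -[|[|[|//]]] ?; case: k => -[|[|[|//]]] ? /=;
  by rewrite ?rmorphN ?rmorph0 ?rmorph1.
rewrite /burau /braid_lift /eval_word.
elim: (repr g)%qT => [|[b i] w IH]; first by rewrite !big_nil /= map_mx1.
rewrite !big_cons /= IH map_mxM; congr (_ *m _).
case: b => /=; last exact: E.
set A := burau_gen q i; have EA : burau_gen (f q) i = map_mx f A :> 'M_3 by [].
have fAU : map_mx f A \in unitmx by rewrite -EA GL_unit.
rewrite EA -[RHS](mulKmx fAU) -map_mxM mulmxV ?GL_unit //.
by rewrite map_mx1 mulmx1.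
Qed.

Definition beta4 : B4 -> GL 3 (laurent int) := burau (laurentq int).

(* Composing beta4 with the ring morphism Z[q, 1/q] -> R sending q to a unit u
   gives burau u: for R = F_t[q, 1/q] and u = q this is the reduction modulo t,
   for R = Q it is the specialization at q = u. *)
Lemma beta4_map (R : comUnitRingType) (u : R) (uU : u \is a GRing.unit) g :
  burau u g = map_mx (laurent_eval (intmul 1) uU) (beta4 g) :> 'M_3.
Proof.
by rewrite -[u in LHS](laurent_eval_q (intmul 1) uU) burau_map ?laurentq_unit.
Qed.

Definition beta4_mod (t : nat) : B4 -> GL 3 (laurent 'F_t) :=
  burau (laurentq 'F_t).
Definition beta4_at (x : rat) : B4 -> GL 3 rat := burau x.

Local Open Scope group_scope.

Definition zexpg (G : groupType) (x : G) (k : int) : G :=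
  match k with Posz n => x ^+ n | Negz n => x ^- n.+1 end.

Definition Delta : B4 :=
  sigma i1 * sigma i2 * sigma i3 * (sigma i1 * sigma i2) * sigma i1.

Definition expansion (s : B4) (w : seq 'I_3) : Prop := s = \prod_(i <- w) sigma i.
Definition positive (s : B4) : Prop := exists w, expansion s w.

Definition garside_nf (g : B4) (k : int) (s : B4) : Prop :=
  [/\ g = zexpg Delta k * s, positive s &
      forall t, positive t -> s <> Delta * t].

Definition minimal_form (s : B4) (w : seq 'I_3) : Prop :=
  expansion s w /\
  forall w', expansion s w' -> (w <= w' :> seqlexi 'I_3)%O.

(* A triple (a, b, c) stands for sigma_1^a sigma_3^b sigma_2^c. *)
Definition syllables := seq (nat * nat * nat).
Definition syl_a (l : syllables) (p : nat) : nat := (nth (0, 0, 0) l p).1.1.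
Definition syl_b (l : syllables) (p : nat) : nat := (nth (0, 0, 0) l p).1.2.
Definition syl_c (l : syllables) (p : nat) : nat := (nth (0, 0, 0) l p).2.

Definition syl_word (l : syllables) : seq 'I_3 :=
  flatten [seq nseq x.1.1 i1 ++ nseq x.1.2 i3 ++ nseq x.2 i2 | x <- l].

Local Open Scope nat_scope.

(* Positions start at 0 here: the textbook index p is p.+1. *)
Definition syl_reduced (l : syllables) : Prop :=
  (forall p, 0 < p < size l -> 0 < syl_a l p + syl_b l p) /\
  (forall p, p.+1 < size l -> 0 < syl_c l p).

Definition normal_cond (l : syllables) : Prop :=
  let a := syl_a l in let b := syl_b l in let c := syl_c l in
  forall p, p.+1 < size l ->
  [/\ a p = 0 -> b p = 1 -> c p <> 1 /\ c p <> 2,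
      0 < p -> a p = 0 -> b p = 1 -> c p <= a p.-1 + 1 -> c p.-1 <> 1,
      0 < b p -> b p + 1 <= a p -> c p = 1 -> a p.+1 <> 2 &
      a p = 1 -> b p = 1 -> c p = 1 -> a p.+1 <> 2].

(* The list l is determined by s, up to a trailing (0, 0, 0) when s = 1. *)
Definition normal_braid (s : B4) : Prop :=
  exists l, [/\ minimal_form s (syl_word l), syl_reduced l & normal_cond l].

(* Main.v *)
Require Import Defs.
From mathcomp Require Import all_boot all_order all_algebra.
From mathcomp Require Import boolp ring zify.

(* The determinant of the Burau matrix is q to the exponent sum, which settles
   k >= 0 and, for k < 0, reduces the claim to showing that the matrices of
   sigma and Delta^m differ, where m = - k > 0.

   Delta acts on row vectors by exchanging the two outer coordinates up to
   units, so it preserves the plane y = 0.  Starting from the first or the last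
   basis vector and multiplying by the syllables of the minimal form one after
   the other, the leading coefficient in q of the middle coordinate y stays a
   signed power of 2, hence y <> 0 at the end: terms of equal degree always add
   up, and the cancellations that could occur are excluded by minimality of the
   form (forbidden subwords such as 212, 3 2 1^a 3, 2 1^k 2 1, 3 2^k 3 2) or by
   the conditions defining normal braids.  A signed power of 2 is nonzero modulo
   an odd prime, and a polynomial with such a leading coefficient does not
   vanish at a/b when b has an odd prime factor.

   The plane y = 0 only fails to detect the braids
   sigma_1^i sigma_3^j (sigma_2 sigma_1 sigma_3 sigma_2)^r.  For these the image
   of the middle basis vector forces i = j = r, so that the braid is Delta^r,
   which is impossible since sigma is not left divisible by Delta. *)

Set Implicit Arguments.
Unset Strict Implicit.
Unset Printing Implicit Defensive.

Import Order.TTheory GRing.Theory Num.Theory.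

Local Open Scope ring_scope.

(** * The right action of positive words on row vectors *)

Section Action.
Variables (R : comNzRingType) (q : R).

(* The row vector (x, y, z) is stored as (x, y, w) with w = - q z, which makes
   the right action of the Burau matrices symmetric under the exchange of
   sigma_1 and sigma_3. *)
Definition act (v : R * R * R) (i : 'I_3) : R * R * R :=
  let '(x, y, w) := v in
  match val i with
  | 0 => (q * (x - y), y, w)
  | 1 => (x, q * y + x + w, w)
  | _ => (x, y, q * (w - y))
  end.

Definition run (v : R * R * R) (u : seq 'I_3) : R * R * R := foldl act v u.

Lemma run_cat v u u' : run v (u ++ u') = run (run v u) u'.
Proof. exact: foldl_cat. Qed.

Definition geom (n : nat) : R := \sum_(i < n) q ^+ i.

Lemma geom0 : geom 0 = 0.
Proof. exact: big_ord0. Qed.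

Lemma geomS n : geom n.+1 = q ^+ n + geom n.
Proof. by rewrite /geom big_ord_recr addrC. Qed.

Lemma exprn_geom n : q ^+ n = 1 + (q - 1) * geom n.
Proof.
elim: n => [|n IH]; first by rewrite geom0 mulr0 addr0.
rewrite geomS mulrDr addrCA -IH exprS; ring.
Qed.

(** The factor [q ^+ 1] and the bracketing give every summand the shape ['X^m * p] or
    [geom 'X c * p] that the tactic [ldt] matches. *)
Definition block (k : nat * nat * nat) (v : R * R * R) : R * R * R :=
  let '(a, b, c) := k in let '(x, y, w) := v in
  let x' := q ^+ a * x - q ^+ 1 * (geom a * y) in
  let w' := q ^+ b * w - q ^+ 1 * (geom b * y) in
  (x', q ^+ c * y + geom c * (x' + w'), w').

Lemma run_block k v : run v (syl_word [:: k]) = block k v.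
Proof.
have r1 n x y w : run (x, y, w) (nseq n i1) = (q ^+ n * x - q * geom n * y, y, w).
  elim: n x => [|n IH] x; first by rewrite geom0 /=; congr (_, _, _); ring.
  by rewrite /= -/(run _ _) IH geomS exprSr; congr (_, _, _); ring.
have r3 n x y w : run (x, y, w) (nseq n i3) = (x, y, q ^+ n * w - q * geom n * y).
  elim: n w => [|n IH] w; first by rewrite geom0 /=; congr (_, _, _); ring.
  by rewrite /= -/(run _ _) IH geomS exprSr; congr (_, _, _); ring.
have r2 n x y w : run (x, y, w) (nseq n i2) = (x, q ^+ n * y + geom n * (x + w), w).
  elim: n y => [|n IH] y; first by rewrite geom0 /=; congr (_, _, _); ring.
  by rewrite /= -/(run _ _) IH geomS exprSr; congr (_, _, _); ring.
case: k => -[a b] c; case: v => -[x y] w.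
rewrite /syl_word /= cats0 !run_cat r1 r3 r2 /block !expr1.
by congr (_, _, _); ring.
Qed.

Lemma run_cons k l v : run v (syl_word (k :: l)) = run (block k v) (syl_word l).
Proof. by rewrite -run_block -run_cat /syl_word /= cats0. Qed.

Definition scale3 (c : R) (v : R * R * R) : R * R * R :=
  let '(x, y, w) := v in (c * x, c * y, c * w).

Lemma run_scale c v u : run (scale3 c v) u = scale3 c (run v u).
Proof.
elim: u v => [//|i u IH] v; rewrite /= -/(run _ _) -IH; congr run.
case: v => -[x y] w; case: i => -[|[|[|//]]] ? /=; congr (_, _, _); ring.
Qed.
End Action.

Lemma run_map (R S : comNzRingType) (f : {rmorphism R -> S}) q x y w u :
  let '(x', y', w') := run q (x, y, w) u in
  run (f q) (f x, f y, f w) u = (f x', f y', f w').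
Proof.
elim: u x y w => [//|i u IH] x y w.
case: i => -[|[|[|//]]] ? /=; rewrite -/(run _ _ _).
- by have := IH (q * (x - y)) y w; rewrite rmorphM rmorphB.
- by have := IH x (q * y + x + w) w; rewrite !rmorphD rmorphM.
- by have := IH x y (q * (w - y)); rewrite rmorphM rmorphB.
Qed.

(** * Leading terms of integer polynomials *)

(* Taking k = 0 expresses that p has degree less than n. *)
Definition ld (p : {poly int}) (n : nat) (k : int) : Prop :=
  (size p <= n.+1)%N /\ p`_n = k.

Lemma ld_at p m n k : ld p m k -> m = n -> ld p n k.
Proof. by move=> ? <-. Qed.
Lemma ld_eq p n k k' : ld p n k' -> k' = k -> ld p n k.
Proof. by move=> ? <-. Qed.
Lemma ld_lt p m n k : ld p m k -> (m < n)%N -> ld p n 0.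
Proof.
case=> sp _ mn; have sn := leq_trans sp mn.
by split; [exact: leqW | rewrite nth_default].
Qed.
Lemma ld_le p m n : ld p m 0 -> (m <= n)%N -> ld p n 0.
Proof. by rewrite leq_eqVlt => pm /predU1P[<- // | /(ld_lt pm)]. Qed.
Lemma ld0 n : ld 0 n 0.
Proof. by split; rewrite ?size_poly0 ?coef0. Qed.
Lemma ld1 : ld 1 0 1.
Proof. by split; rewrite ?size_poly1 ?coef1. Qed.
Lemma ldD p p' n k k' : ld p n k -> ld p' n k' -> ld (p + p') n (k + k').
Proof.
move=> [sp pn] [sp' pn']; split; last by rewrite coefD pn pn'.
by apply: leq_trans (size_polyD _ _) _; rewrite geq_max sp.
Qed.
Lemma ldN p n k : ld p n k -> ld (- p) n (- k).
Proof. by move=> [sp pn]; split; rewrite ?size_polyN ?coefN ?pn. Qed.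
Lemma ldXn p n m k : (m <= n)%N -> ld p (n - m) k -> ld ('X^m * p) n k.
Proof.
move=> mn [sp pn]; split; last by rewrite coefXnM pn ltnNge mn.
have [->|p0] := eqVneq p 0; first by rewrite mulr0 size_poly0.
by rewrite mulrC size_mulXn // -(subnKC mn) -addnS leq_add2l.
Qed.
(** [geom 'X c] is monic of degree [c - 1]; in the induction the lower powers of ['X] contribute
    only below degree [n]. *)
Lemma ld_geom p n c k : (0 < c)%N -> (c.-1 <= n)%N -> ld p (n - c.-1) k ->
  ld (geom 'X c * p) n k.
Proof.
case: c => [//|c] _ /=; elim: c n k => [|c IH] n k cn pn.
  by rewrite geomS geom0 addr0 mul1r -[n]subn0.
rewrite geomS mulrDl; apply: (@ld_eq _ _ _ (k + 0)); last by rewrite addr0.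
apply: ldD; first exact: ldXn.
apply: (@ld_lt _ n.-1 _ k); last lia.
by apply: IH; [lia | apply: ld_at pn _; lia].
Qed.

(** Recursion on the shape of the polynomial, with the degree given and the coefficient an
    existential variable; terms of smaller degree contribute 0. [ldtac] then compares the
    coefficient found with the expected one by [ring]. *)
Ltac ldt :=
  lazymatch goal with
  | H : ld ?p _ _ |- ld ?p _ _ =>
      first [eapply (ld_at H); lia | eapply (ld_lt H); lia | eapply (ld_le H); lia]
  | |- ld (_ + _) _ _ => eapply ldD; ldt
  | |- ld (- _) _ _ => eapply ldN; ldt
  | |- ld ('X^_ * _) _ _ => eapply ldXn; [lia | ldt]
  | |- ld (geom 'X _ * _) _ _ => eapply ld_geom; [lia | lia | ldt]
  | |- ld 0 _ _ => eapply ld0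
  | |- ld 1 _ _ => first [eapply (ld_at ld1); lia | eapply (ld_lt ld1); lia]
  end.
Ltac ldtac := eapply ld_eq; [ldt | try ring].

Definition good (s : int) : Prop := exists k : nat, s = 2 ^+ k \/ s = - 2 ^+ k.
Lemma good1 : good 1. Proof. by exists 0%N; left. Qed.
Lemma goodN s : good s -> good (- s).
Proof. by case=> k [->|->]; exists k; rewrite ?opprK; [right | left]. Qed.
Lemma good2 s : good s -> good (2 * s).
Proof. by case=> k [->|->]; exists k.+1; rewrite exprS ?mulrN; [left | right]. Qed.

(** * Positive words and the subwords that minimality forbids *)

Section Words.
Local Open Scope group_scope.

Definition word_braid (u : seq 'I_3) : B4 := \prod_(i <- u) sigma i.

Lemma word_braid_cat u u' : word_braid (u ++ u') = word_braid u * word_braid u'.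
Proof. exact: big_cat. Qed.
Lemma word_braid_cons i u : word_braid (i :: u) = sigma i * word_braid u.
Proof. exact: big_cons. Qed.
Lemma word_braid_nil : word_braid [::] = 1.
Proof. exact: big_nil. Qed.
Lemma word_braid_nseq n i : word_braid (nseq n i) = sigma i ^+ n.
Proof.
elim: n => [|n IH]; first by rewrite word_braid_nil.
by rewrite /= word_braid_cons IH expgS.
Qed.

Local Notation s1 := (sigma i1).
Local Notation s2 := (sigma i2).
Local Notation s3 := (sigma i3).

Lemma braid_of_pos i u : braid_of (pos (i :: u)) = sigma i * braid_of (pos u).
Proof. exact: (braid_of_cat [:: (false, i)]). Qed.

Lemma sigma121 : s1 * s2 * s1 = s2 * s1 * s2.
Proof.
have := proj2 (braid_of_eq _ _) Braid121; rewrite !braid_of_pos.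
by rewrite (_ : braid_of _ = 1) // !mulg1 !mulgA.
Qed.
Lemma sigma232 : s2 * s3 * s2 = s3 * s2 * s3.
Proof.
have := proj2 (braid_of_eq _ _) Braid232; rewrite !braid_of_pos.
by rewrite (_ : braid_of _ = 1) // !mulg1 !mulgA.
Qed.
Lemma sigma13 : s1 * s3 = s3 * s1.
Proof.
have := proj2 (braid_of_eq _ _) Braid13; rewrite !braid_of_pos.
by rewrite (_ : braid_of _ = 1) // !mulg1.
Qed.

Lemma expg_intertwine (G : groupType) (x y c : G) n :
  x * c = c * y -> x ^+ n * c = c * y ^+ n.
Proof.
move=> xc; elim: n => [|n IH]; first by rewrite mul1g mulg1.
by rewrite expgSr -mulgA xc mulgA IH -mulgA -expgSr.
Qed.

Lemma sigma1_21 n : s1 ^+ n * (s2 * s1) = s2 * s1 * s2 ^+ n.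
Proof. by apply: expg_intertwine; rewrite mulgA sigma121. Qed.
Lemma sigma2_32 n : s2 ^+ n * (s3 * s2) = s3 * s2 * s3 ^+ n.
Proof. by apply: expg_intertwine; rewrite mulgA sigma232. Qed.
Lemma sigma1_3 n : s1 ^+ n * s3 = s3 * s1 ^+ n.
Proof. by apply: expg_intertwine; rewrite sigma13. Qed.

Definition lexmin (u : seq 'I_3) : Prop :=
  forall u', word_braid u = word_braid u' -> (u <= u' :> seqlexi 'I_3)%O.

Lemma lexmin_suffix u v : lexmin (u ++ v) -> lexmin v.
Proof.
move=> uvP v' vv'; have /uvP : word_braid (u ++ v) = word_braid (u ++ v').
  by rewrite !word_braid_cat vv'.
by elim: u {uvP} => [//|i u IH] /=; rewrite lexi_cons lexx /=.
Qed.

(** If a subword equals a word with a smaller first letter, replacing it gives a smaller expansion.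
    Every forbidden subword below is excluded in this way. *)
Lemma lexmin_head u i v w j v' : lexmin (u ++ (i :: v) ++ w) ->
  word_braid (i :: v) = word_braid (j :: v') -> (i <= j)%N.
Proof.
move=> /lexmin_suffix wP ij; have /wP : word_braid ((i :: v) ++ w) = word_braid ((j :: v') ++ w).
  by rewrite !word_braid_cat ij.
by rewrite lexi_cons => /andP[].
Qed.

Ltac word_expand :=
  rewrite ?(word_braid_cat, word_braid_cons, word_braid_nseq, word_braid_nil)
    ?mulg1 ?expgS ?mulgA.

Lemma lexmin_212 u w : ~ lexmin (u ++ [:: i2; i1; i2] ++ w).
Proof.
move=> /lexmin_head h; suff: (i2 <= i1)%N by [].
by apply: (h i1 [:: i2; i1]); word_expand; rewrite sigma121.
Qed.

(** 3 2 1^k 3 = 3 2 3 1^k = 2 3 2 1^k. *)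
Lemma lexmin_321k3 u w k : ~ lexmin (u ++ (i3 :: i2 :: nseq k i1 ++ [:: i3]) ++ w).
Proof.
move=> /lexmin_head h; suff: (i3 <= i2)%N by [].
apply: (h i2 (i3 :: i2 :: nseq k i1)); word_expand.
by rewrite sigma232 -!mulgA sigma1_3.
Qed.

(** 2 1^(k+1) 2 1 = 2 2 1 2^(k+1) = 2 1 2 1 2^k = 1 2 1 1 2^k. *)
Lemma lexmin_21k21 u w k : ~ lexmin (u ++ (i2 :: nseq k.+1 i1 ++ [:: i2; i1]) ++ w).
Proof.
move=> /lexmin_head h; suff: (i2 <= i1)%N by [].
apply: (h i1 (i2 :: i1 :: i1 :: nseq k i2)).
rewrite !word_braid_cons !word_braid_cat !word_braid_nseq !word_braid_cons word_braid_nil mulg1.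
by rewrite sigma1_21 !mulgA -sigma121.
Qed.

Lemma word_32k32 k : word_braid (i3 :: nseq k.+1 i2 ++ [:: i3; i2]) =
  word_braid (i2 :: i3 :: i2 :: i2 :: nseq k i3).
Proof.
rewrite !word_braid_cons !word_braid_cat !word_braid_nseq !word_braid_cons word_braid_nil mulg1.
by rewrite sigma2_32 !mulgA -sigma232.
Qed.

Lemma lexmin_32k32 u w k : ~ lexmin (u ++ (i3 :: nseq k.+1 i2 ++ [:: i3; i2]) ++ w).
Proof.
by move=> /lexmin_head h; have := h _ _ (word_32k32 k).
Qed.

(** 3 2 1^a 2^c 3 2 = 3 2 1^a 3 2 3^c = 3 2 3 1^a 2 3^c = 2 3 2 1^a 2 3^c. *)
Lemma lexmin_321a2c32 u w a c :
  ~ lexmin (u ++ (i3 :: i2 :: nseq a i1 ++ nseq c i2 ++ [:: i3; i2]) ++ w).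
Proof.
move=> /lexmin_head h; suff: (i3 <= i2)%N by [].
apply: (h i2 (i3 :: i2 :: nseq a i1 ++ i2 :: nseq c i3)).
rewrite !(word_braid_cons, word_braid_cat, word_braid_nseq, word_braid_nil) mulg1.
by rewrite sigma2_32 (mulgA (s1 ^+ a)) (mulgA (s1 ^+ a)) sigma1_3 !mulgA sigma232.
Qed.

(** Commuting 1 with 3 and then using 1 2 1 = 2 1 2 turns the end into 3 2 1 2, so that [word_32k32]
    applies. *)
Lemma lexmin_32k1321 u w k :
  ~ lexmin (u ++ (i3 :: nseq k.+1 i2 ++ [:: i1; i3; i2; i1]) ++ w).
Proof.
move=> /lexmin_head h; suff: (i3 <= i2)%N by [].
apply: (h i2 ([:: i3, i2, i2 & nseq k i3] ++ [:: i1; i2])).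
rewrite [RHS](word_braid_cat [:: i2, i3, i2, i2 & nseq k i3]) -word_32k32.
rewrite !(word_braid_cons, word_braid_cat, word_braid_nseq, word_braid_nil) !mulg1.
by rewrite (mulgA s1) sigma13 -!mulgA (mulgA s1 s2) sigma121 !mulgA.
Qed.

(** * Consequences of minimality and normality for consecutive syllables *)

Definition ok (l : syllables) : Prop :=
  [/\ lexmin (syl_word l), syl_reduced l & normal_cond l].

Lemma syl_word_cons a b c l :
  syl_word ((a, b, c) :: l) = nseq a i1 ++ nseq b i3 ++ nseq c i2 ++ syl_word l.
Proof. by rewrite /syl_word /= -!catA. Qed.

Local Open Scope nat_scope.

Lemma ok_behead k l : ok (k :: l) -> ok l.
Proof.
case: k => -[a b] c [lP [r1 r2] nP]; split.
- by move: lP; rewrite syl_word_cons !catA; apply: lexmin_suffix.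
- split=> p pl; [have := r1 p.+1 | have := r2 p.+1]; apply=> //.
  by case/andP: pl.
- move=> p pl; have /(_ pl) [h1 h2 h3 h4] := nP p.+1; split=> //.
  by move=> p0; have := h2 isT; case: p p0 {pl h1 h2 h3 h4}.
Qed.

Lemma ok_c_gt0 a0 b0 c0 a b c l : ok ((a0, b0, c0) :: (a, b, c) :: l) -> 0 < c0.
Proof. by case=> _ [_ /(_ 0)] + _; apply. Qed.

Lemma ok_ab_gt0 a0 b0 c0 a b c l : ok ((a0, b0, c0) :: (a, b, c) :: l) -> 0 < a + b.
Proof. by case=> _ [/(_ 1) + _] _; apply. Qed.

Lemma ok_01c c0 a b c l : ok ((0, 1, c0) :: (a, b, c) :: l) -> 2 < c0.
Proof.
move=> okl; case: (okl) => _ _ /(_ 0 isT) [/(_ erefl erefl)[h1 h2] _ _ _].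
have := ok_c_gt0 okl; move: h1 h2; rewrite /syl_c /= => ? ? ?; lia.
Qed.

(** The syllable [k] makes the one before it non-final, as the normality clauses require. *)
Lemma ok_1_01c a0 b0 c k l : ok ((a0, b0, 1) :: (0, 1, c) :: k :: l) -> a0 + 1 < c.
Proof.
case=> _ _ /(_ 1 isT) [_ /(_ isT erefl erefl) h _ _].
by rewrite ltnNge; apply/negP => /h; apply.
Qed.

Lemma ok_neq2 a0 b0 a b c l : ok ((a0, b0, 1) :: (a, b, c) :: l) ->
  0 < b0 -> b0 < a0 \/ (a0 = 1 /\ b0 = 1) -> a != 2.
Proof.
case=> _ _ /(_ 0 isT) [_ _ h3 h4] b0P [ba|[a1 b1]]; apply/eqP.
  by apply: h3 => //; rewrite /syl_a /syl_b /=; lia.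
by apply: h4.
Qed.

Lemma ok_not_212 a0 b0 c0 c l :
  0 < c0 -> 0 < c -> ~ ok ((a0, b0, c0) :: (1, 0, c) :: l).
Proof.
case: c0 => [//|c0] _; case: c => [//|c] _ [+ _ _].
rewrite (_ : syl_word _ = (nseq a0 i1 ++ nseq b0 i3 ++ nseq c0 i2) ++
  [:: i2; i1; i2] ++ (nseq c i2 ++ syl_word l)); first exact: lexmin_212.
by rewrite !syl_word_cons -(addn1 c0) nseqD -!catA.
Qed.

Lemma ok_32_b a0 b0 a b c l :
  0 < b0 -> ok ((a0, b0, 1) :: (a, b, c) :: l) -> b = 0.
Proof.
case: b0 => [//|b0] _ [+ _ _]; case: b => [//|b].
rewrite (_ : syl_word _ = (nseq a0 i1 ++ nseq b0 i3) ++
  (i3 :: i2 :: nseq a i1 ++ [:: i3]) ++ (nseq b i3 ++ nseq c i2 ++ syl_word l)).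
  by move/lexmin_321k3.
by rewrite !syl_word_cons -(addn1 b0) nseqD -!catA /= -!catA.
Qed.

Lemma ok_21k21 a0 b0 c0 a a' b' c' l : 0 < c0 -> 0 < a ->
  ok ((a0, b0, c0) :: (a, 0, 1) :: (a', b', c') :: l) -> a' = 0.
Proof.
case: c0 => [//|c0] _; case: a => [//|a] _ [+ _ _]; case: a' => [//|a'].
rewrite (_ : syl_word _ = (nseq a0 i1 ++ nseq b0 i3 ++ nseq c0 i2) ++
  (i2 :: nseq a.+1 i1 ++ [:: i2; i1]) ++
  (nseq a' i1 ++ nseq b' i3 ++ nseq c' i2 ++ syl_word l)).
  by move/lexmin_21k21.
by rewrite !syl_word_cons -(addn1 c0) nseqD -!catA /= -!catA.
Qed.

Lemma ok_32k32 a0 b0 c0 c l :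
  0 < b0 -> 0 < c0 -> 0 < c -> ~ ok ((a0, b0, c0) :: (0, 1, c) :: l).
Proof.
case: b0 => [//|b0] _; case: c0 => [//|c0] _; case: c => [//|c] _ [+ _ _].
rewrite (_ : syl_word _ = (nseq a0 i1 ++ nseq b0 i3) ++
  (i3 :: nseq c0.+1 i2 ++ [:: i3; i2]) ++ (nseq c i2 ++ syl_word l)).
  exact: lexmin_32k32.
by rewrite !syl_word_cons -(addn1 b0) nseqD -!catA /= -!catA.
Qed.

Lemma ok_321a2c32 a0 b0 a c c' l : 0 < b0 -> 0 < c' ->
  ~ ok ((a0, b0, 1) :: (a, 0, c) :: (0, 1, c') :: l).
Proof.
case: b0 => [//|b0] _; case: c' => [//|c'] _ [+ _ _].
rewrite (_ : syl_word _ = (nseq a0 i1 ++ nseq b0 i3) ++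
  (i3 :: i2 :: nseq a i1 ++ nseq c i2 ++ [:: i3; i2]) ++ (nseq c' i2 ++ syl_word l)).
  exact: lexmin_321a2c32.
by rewrite !syl_word_cons -(addn1 b0) nseqD -!catA /= -!catA.
Qed.

Lemma ok_32k1321 a0 b0 c0 a b c l : 0 < b0 -> 0 < c0 -> 0 < a ->
  ~ ok ((a0, b0, c0) :: (1, 1, 1) :: (a, b, c) :: l).
Proof.
case: b0 => [//|b0] _; case: c0 => [//|c0] _; case: a => [//|a] _ [+ _ _].
rewrite (_ : syl_word _ = (nseq a0 i1 ++ nseq b0 i3) ++
  (i3 :: nseq c0.+1 i2 ++ [:: i1; i3; i2; i1]) ++ (nseq a i1 ++ nseq b i3 ++ nseq c i2 ++ syl_word l)).
  exact: lexmin_32k1321.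
by rewrite !syl_word_cons -(addn1 b0) nseqD -!catA /= -!catA.
Qed.

End Words.

(** * The leading term of the middle coordinate along the syllables *)

Definition detects (v : {poly int} * {poly int} * {poly int}) (u : seq 'I_3) :=
  exists n s, good s /\ ld (run 'X v u).1.2 n s.

Definition alive v l := detects v (syl_word l).

Lemma alive_cons k v l : alive (block 'X k v) l -> alive v (k :: l).
Proof. by rewrite /alive /detects run_cons. Qed.

Lemma alive_nil x y w n s : good s -> ld y n s -> alive (x, y, w) [::].
Proof. by exists n, s. Qed.

(** Reducedness allows [c = 0] only in the last syllable, which then leaves [y] unchanged. *)
Lemma alive_c0 a b t x y w n s : ok ((a, b, 0%N) :: t) -> good s -> ld y n s ->
  alive (block 'X (a, b, 0%N) (x, y, w)) t.
Proof.
case: t => [|[[a' b'] c'] t].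
  by move=> _ sP yP; apply: (alive_nil _ _ sP); rewrite expr0 mul1r geom0 mul0r addr0; exact: yP.
move=> okt _ _. have := ok_c_gt0 okt. by [].
Qed.

Lemma block0b b c x y w : block 'X (0%N, b, c) (x, y, w) =
  let w' := 'X^b * w - 'X^1 * (geom 'X b * y) in
  (x, 'X^c * y + geom 'X c * (x + w'), w') :> {poly int} * {poly int} * {poly int}.
Proof. by rewrite /block geom0 !expr0 !mul1r mul0r mulr0 subr0. Qed.

Lemma blocka0 a c x y w : block 'X (a, 0%N, c) (x, y, w) =
  let x' := 'X^a * x - 'X^1 * (geom 'X a * y) in
  (x', 'X^c * y + geom 'X c * (x' + w), w) :> {poly int} * {poly int} * {poly int}.
Proof. by rewrite /block geom0 !expr0 !mul1r mul0r mulr0 subr0. Qed.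

(* The states after a block (a0, b0, c0), by leading terms.
   alive_D: y dominates x and w.  The other three occur when c0 = 1.
   alive_xy: x and y agree to leading order, but only sigma_3 can follow.
   alive_x_neq_y: x - y has the degree of y, so that sigma_1 cancels nothing.
   alive_x_near_y: x - y may be small; the next block has a >= 3, and then x is
   governed by q (y - x) + y. *)
Definition alive_D l := forall a0 b0 c0 (x y w : {poly int}) n s,
  ok ((a0, b0, c0) :: l) -> (0 < c0)%N -> good s ->
  ld y n s -> ld x n 0 -> ld w n 0 ->
  (b0 = 0%N -> ld ('X^1 * w) n 0) ->
  (b0 = 0%N -> l = [:: (0, 1, 1)%N] ->
    exists m s', good s' /\ ld (x + 'X^1 * w) m s') ->
  alive (x, y, w) l.

Definition alive_xy l := forall a0 b0 c0 a (x y w : {poly int}) n s,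
  ok ((a0, b0, c0) :: (a, 0%N, 1%N) :: l) -> (0 < c0)%N -> (0 < a)%N -> good s ->
  ld y n s -> ld (x - y) n 0 -> ld w n 0 ->
  (forall c l', l = (0, 1, c.+1)%N :: l' -> exists p m,
     [/\ n = (m + a)%N, ld p m (- s), y - x = 'X^1 * p + w & ld w m 0]) ->
  alive (x, y, w) l.

Definition alive_x_neq_y l := forall a0 b0 (x y w : {poly int}) n s s' k,
  ok ((a0, b0, 1%N) :: l) -> (0 < b0)%N -> good s -> good s' ->
  ld y n s -> ld (x - y) n s' -> ld w n k ->
  alive (x, y, w) l.

Definition alive_x_near_y l := forall a0 b0 (x y w : {poly int}) n s s' k,
  ok ((a0, b0, 1%N) :: l) -> (0 < b0)%N ->
  (b0 < a0)%N \/ (a0 = 1%N /\ b0 = 1%N) -> good s -> good s' ->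
  ld y n s -> ld ('X^1 * (y - x) + y) n s' -> ld w n k ->
  alive (x, y, w) l.

Lemma alive_x_neq_y_step a b c l : alive_D l -> alive_xy l ->
  alive_x_neq_y ((a, b, c) :: l).
Proof.
move=> hD hxy a0 b0 x y w n s s' k okl b0P sP s'P yP xyP wP; apply: alive_cons.
have okl' := ok_behead okl.
have [c0|c_gt0] := posnP c.
  by rewrite c0 in okl' *; apply: alive_c0 sP yP.
have b_0 := ok_32_b b0P okl; subst b.
have abP := ok_ab_gt0 okl.
have a1 : a != 1%N.
  by apply/eqP => a1; rewrite a1 in okl; apply: (ok_not_212 _ c_gt0 okl).
have F7 c' l' : l = (0, 1, c'.+1)%N :: l' -> False.
  by move=> lE; rewrite lE in okl; apply: (ok_321a2c32 b0P _ okl).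
rewrite blocka0; set x' := _ - _.
case: a => [|a] in okl okl' abP a1 x' *; first by [].
(* Splitting off the top power of [geom] shows that [x - y] governs the leading term of [x']. *)
have x'E : x' = 'X^(a.+1) * (x - y) - 'X^1 * (geom 'X a * y).
  by rewrite /x' geomS exprS; ring.
have x'P : ld x' (n + a.+1) s' by rewrite x'E; ldtac.
move: x' x'E x'P => x' x'E x'P /=.
case: c => [//|[|c]] in okl okl' c_gt0 *.
  apply: (hxy _ _ _ _ _ _ _ (n + a.+1)%N s' okl) => //.
  - ldtac.
  - rewrite (_ : _ - _ = - ('X^1 * y + w)); first ldtac.
    by rewrite /geom big_ord_recl big_ord0 expr0; ring.
  - ldtac.
  - by move=> c l' /F7.
apply: (hD _ _ _ _ _ _ (n + a.+1 + c.+1)%N s' okl') => //.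
- ldtac.
- ldtac.
- ldtac.
- move=> _; ldtac.
- by move=> _ /F7.
Qed.

Lemma alive_x_near_y_step a b c l : alive_D l -> alive_xy l ->
  alive_x_near_y ((a, b, c) :: l).
Proof.
move=> hD hxy a0 b0 x y w n s s' k okl b0P ab0 sP s'P yP xyP wP; apply: alive_cons.
have okl' := ok_behead okl.
have [c0|c_gt0] := posnP c.
  by rewrite c0 in okl' *; apply: alive_c0 sP yP.
have b_0 := ok_32_b b0P okl; subst b.
have abP := ok_ab_gt0 okl.
have a1 : a != 1%N.
  by apply/eqP => a1; rewrite a1 in okl; apply: (ok_not_212 _ c_gt0 okl).
(* Normality excludes [a = 2]; with [a >= 3] the two top powers of [geom] split off and leave a tail
   of lower degree. *)
have a2 := ok_neq2 okl b0P ab0.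
have F7 c' l' : l = (0, 1, c'.+1)%N :: l' -> False.
  by move=> lE; rewrite lE in okl; apply: (ok_321a2c32 b0P _ okl).
rewrite blocka0; set x' := _ - _.
case: a => [|[|[|a]]] in okl okl' abP a1 a2 x' *; [by []|by []|by []|].
have x'E : x' = - ('X^(a.+2) * ('X^1 * (y - x) + y)) - 'X^1 * (geom 'X a.+1 * y).
  by rewrite /x' [geom 'X a.+3]geomS [geom 'X a.+2]geomS !exprS; ring.
have x'P : ld x' (n + a.+2) (- s') by rewrite x'E; ldtac.
move: x' x'E x'P => x' x'E x'P /=.
have gs' := goodN s'P.
case: c => [//|[|c]] in okl okl' c_gt0 *.
  apply: (hxy _ _ _ _ _ _ _ (n + a.+2)%N (- s') okl) => //.
  - ldtac.
  - rewrite (_ : _ - _ = - ('X^1 * y + w)); first ldtac.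
    by rewrite /geom big_ord_recl big_ord0 expr0; ring.
  - ldtac.
  - by move=> c l' /F7.
apply: (hD _ _ _ _ _ _ (n + a.+2 + c.+1)%N (- s') okl') => //.
- ldtac.
- ldtac.
- ldtac.
- move=> _; ldtac.
- by move=> _ /F7.
Qed.

Lemma alive_xy_step a b c l : alive_D l -> alive_x_neq_y l ->
  alive_xy ((a, b, c) :: l).
Proof.
move=> hD hneq a0 b0 c0 e x y w n s okl c0P eP sP yP xyP wP yp; apply: alive_cons.
have okl1 := ok_behead okl; have okl' := ok_behead okl1.
have [cz|c_gt0] := posnP c.
  by rewrite cz in okl' *; apply: alive_c0 sP yP.
have a_0 := ok_21k21 c0P eP okl; subst a.
have bP := ok_ab_gt0 okl1; rewrite add0n in bP.
have gNs := goodN sP.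
have F6 l' : l = (0, 1, 1)%N :: l' -> False.
  by move=> lE; rewrite lE in okl'; apply: (ok_32k32 bP c_gt0 _ okl').
rewrite block0b; set w' := _ - _.
have xP : ld x n s by rewrite -[x](subrK y); ldtac.
case: b => [//|[|b]] in okl okl1 okl' bP w' yp F6 *.
  case: c => [//|c] in okl okl1 okl' c_gt0 yp F6 *.
  have [p [m [nE pP yxE wmP]]] := yp _ _ erefl.
  have w'P : ld w' n.+1 (- s).
    by rewrite /w'; ldtac.
  (* Substituting [y - x = 'X^1 * p + w] leaves two competing terms, of degrees [m + e] and
     [m + c.+1]. Both have coefficient [s], so they add up when the degrees agree. *)
  have y'E : 'X^(c.+1) * y + geom 'X c.+1 * (x + w') =
      y - 'X^1 * (geom 'X c.+1 * p) + ('X^(c.+1) * w - w).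
    rewrite /w' [geom 'X 1]geomS geom0 (_ : x = y - ('X^1 * p + w)).
      by rewrite (exprn_geom _ c.+1) expr0; ring.
    by rewrite -yxE; ring.
  move: w' w'P y'E => w' w'P /= ->.
  case: l hD hneq okl okl1 okl' yp F6 => [|[[a' b'] c'] l] hD hneq okl okl1 okl' yp F6.
    have [ce|ce|ce] := ltngtP c.+1 e.
    - by apply: (@alive_nil _ _ _ n s) => //; ldtac.
    - by apply: (@alive_nil _ _ _ (m + c.+1)%N s) => //; ldtac.
    - by apply: (@alive_nil _ _ _ n (2 * s)); [exact: good2 | ldtac].
  (* By normality [c.+1 >= e + 2], so the new [y], of degree [m + c.+1], dominates [w'], of degree
     [n + 1 = m + e + 1]. *)
  have ce := ok_1_01c okl1.
  apply: (hD _ _ _ _ _ _ (m + c.+1)%N s okl') => //.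
  - ldtac.
  - ldtac.
  - ldtac.
have w'P : ld w' (n + b.+2) (- s) by rewrite /w'; ldtac.
move: w' w'P {yp} => w' w'P /=.
case: c => [//|[|c]] in okl okl1 okl' c_gt0 F6 *.
  apply: (hneq _ _ _ _ _ (n + b.+2)%N (- s) s (- s) okl') => //.
  - ldtac.
  - ldtac.
apply: (hD _ _ _ _ _ _ (n + b.+2 + c.+1)%N (- s) okl') => //.
- ldtac.
- ldtac.
- ldtac.
Qed.

Lemma alive_D_step k l : alive_D l -> alive_xy l -> alive_x_neq_y l ->
  alive_x_near_y l -> alive_D (k :: l).
Proof.
case: k => -[a b] c hD hxy hneq hnear a0 b0 c0 x y w n s okl c0P sP yP xP wP XwP endP.
apply: alive_cons; have okl' := ok_behead okl.
have [cz|c_gt0] := posnP c.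
  by rewrite cz in okl' *; apply: alive_c0 sP yP.
have abP := ok_ab_gt0 okl.
have gNs := goodN sP; have g2Ns := goodN (good2 sP).
have F6 c' l' : (0 < b)%N -> l = (0, 1, c'.+1)%N :: l' -> False.
  by move=> bP lE; rewrite lE in okl'; apply: (ok_32k32 bP c_gt0 _ okl').
have [aE|a_gt0] := posnP a.
  subst a; rewrite add0n in abP; rewrite block0b; set w' := _ - _.
  case: b => [//|[|b]] in okl okl' abP w' endP F6 *.
    have b0E : b0 = 0%N.
      by case: (posnP b0) => // b0P; case: (ok_32k32 b0P c0P c_gt0 okl).
    have {}XwP := XwP b0E.
    (* A lone sigma_3 cancels the top term: the new degree is [n + c - 1] when [c >= 2]. For [c = 1]
       even [y] drops out and leaves [x + 'X^1 * w], which the last hypothesis of [alive_D]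
       controls. *)
    have y'E : 'X^c * y + geom 'X c * (x + w') =
        y + geom 'X c * (x - y + 'X^1 * w).
      rewrite /w' [geom 'X 1]geomS geom0.
      by rewrite (exprn_geom _ c) expr0; ring.
    have w'P : ld w' n.+1 (- s).
      by rewrite /w'; ldtac.
    move: w' w'P y'E => w' w'P /= ->.
    case: c => [//|[|c]] in okl okl' c_gt0 endP F6 *.
      case: l => [|[[a' b'] c'] l] in hD hxy hneq hnear okl okl' endP F6 *; last first.
        by have := ok_01c okl'.
      have [m [s' [s'P mP]]] := endP b0E erefl.
      apply: (alive_nil _ _ s'P (n := m)).
      rewrite (_ : _ + _ = x + 'X^1 * w) //.
      by rewrite geomS geom0 expr0; ring.
    case: l => [|[[a' b'] c'] l] in hD hxy hneq hnear okl okl' endP F6 *.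
      by apply: (@alive_nil _ _ _ (n + c.+1) (- s)) => //; ldtac.
    (* By normality the exponent of sigma_2 is at least 3, so [y], now of degree at least [n + 2],
       dominates [w'], of degree [n + 1]. *)
    have c3 := ok_01c okl'.
    apply: (hD _ _ _ _ _ _ (n + c.+1)%N (- s) okl') => //.
    - ldtac.
    - ldtac.
    - ldtac.
  have w'P : ld w' (n + b.+2) (- s) by rewrite /w'; ldtac.
  move: w' w'P {endP} => w' w'P /=.
  case: c => [//|[|c]] in okl okl' c_gt0 F6 *.
    apply: (hneq _ _ _ _ _ (n + b.+2)%N (- s) s (- s) okl') => //.
    - ldtac.
    - ldtac.
  apply: (hD _ _ _ _ _ _ (n + b.+2 + c.+1)%N (- s) okl') => //.
  - ldtac.
  - ldtac.
  - ldtac.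
move: endP => _.
have [bE|b_gt0] := posnP b.
  subst b; rewrite blocka0; set x' := _ - _.
  have a1 : a != 1%N.
    by apply/eqP => a1; rewrite a1 in okl; apply: (ok_not_212 c0P c_gt0 okl).
  case: a => [//|[//|a]] in okl okl' a_gt0 a1 abP x' F6 *.
  have x'P : ld x' (n + a.+2) (- s) by rewrite /x'; ldtac.
  move: x' x'P => x' x'P /=.
  case: c => [//|[|c]] in okl okl' c_gt0 F6 *.
    have x'yE : x' - ('X^1 * y + geom 'X 1 * (x' + w)) = - ('X^1 * y + w).
      by rewrite geomS geom0 expr0; ring.
    apply: (hxy _ _ _ _ _ _ _ (n + a.+2)%N (- s) okl) => //.
    - ldtac.
    - by rewrite x'yE; ldtac.
    - ldtac.
    (* The witness [p] is the middle coordinate before the present syllable. *)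
    - move=> c l' _; exists y, n; split => //; first by rewrite opprK.
      by rewrite -[LHS]opprB x'yE opprK.
  apply: (hD _ _ _ _ _ _ (n + a.+2 + c.+1)%N (- s) okl') => //.
  - ldtac.
  - ldtac.
  - ldtac.
  - move=> _; ldtac.
  - by move=> _ _; exists (n + a.+2)%N, (- s); split => //; ldtac.
rewrite /block; set x' := _ - _; set w' := _ - _.
(* Both outer coordinates now lead with the same coefficient [- s], so they cannot cancel each other
   in the new [y]. *)
have x'P : ld x' (n + a) (- s) by rewrite /x'; ldtac.
have w'P : ld w' (n + b) (- s) by rewrite /w'; ldtac.
case: c => [//|[|c]] in okl okl' c_gt0 F6 *; last first.
  move: x' w' x'P w'P => x' w' x'P w'P /=.
  have [ab|ab|ab] := ltngtP a b.
  - apply: (hD _ _ _ _ _ _ (n + b + c.+1)%N (- s) okl') => //; try by ldtac.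
    + by move=> bE; rewrite bE in b_gt0.
    + by move=> _ /(F6 _ _ b_gt0).
  - apply: (hD _ _ _ _ _ _ (n + a + c.+1)%N (- s) okl') => //; try by ldtac.
    + by move=> bE; rewrite bE in b_gt0.
    + by move=> _ /(F6 _ _ b_gt0).
  (* For [a = b = 1] the term in [y] has the degree of the two others, and [s - s - s = - s]; for
     [a = b >= 2] it is of lower degree and the others give [- (2 * s)]. *)
  - have [b1|b1] := eqVneq b 1%N.
    + apply: (hD _ _ _ _ _ _ (n + c.+2)%N (- s) okl') => //; try by ldtac.
        by move=> bE; rewrite bE in b_gt0.
      by move=> _ /(F6 _ _ b_gt0).
    + apply: (hD _ _ _ _ _ _ (n + a + c.+1)%N (- (2 * s)) okl') => //; try by ldtac.
        by move=> bE; rewrite bE in b_gt0.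
      by move=> _ /(F6 _ _ b_gt0).
have [ab|ab|ab] := ltngtP a b.
- apply: (hneq _ _ _ _ _ (n + b)%N (- s) s (- s) okl') => //; try by ldtac.
- have [b1|b1] := eqVneq b 1%N.
    apply: (hnear _ _ _ _ _ (n + a)%N (- s) (- s) 0 okl') => //; try by ldtac.
    + by left.
    + rewrite (_ : _ + _ = 'X^2 * w + ('X^1 * y + geom 'X 1 * (x' + w'))); first by ldtac.
      by rewrite /w' b1 geomS geom0 expr0; ring.
  have y'P : ld ('X^1 * y + geom 'X 1 * (x' + w') - x') (n + b) (- s).
    rewrite (_ : _ - x' = 'X^1 * y + w'); first by ldtac.
    by rewrite geomS geom0 expr0; ring.
  (* ['X^1 * (y - x)] has degree [n + b + 1], which ties with the degree [n + a] of [y] exactly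
     here; the coefficients agree and double. *)
  have [ab1|ab1] := eqVneq a b.+1.
    apply: (hnear _ _ _ _ _ (n + a)%N (- s) (- (2 * s)) 0 okl') => //; try by ldtac.
    by left.
  apply: (hnear _ _ _ _ _ (n + a)%N (- s) (- s) 0 okl') => //; try by ldtac.
  by left.
- have [b1|b1] := eqVneq b 1%N.
    have y'P : ld ('X^1 * y + geom 'X 1 * (x' + w')) n.+1 (- s) by ldtac.
    case: l => [|[[a' b'] c'] l] in hD hxy hneq hnear okl okl' F6 *.
      exact: alive_nil y'P.
    subst b; subst a.
    (* If [b0 > 0], the next syllable has [b' = 0], hence [a' > 0], which creates the forbidden 3
       2^k 1 3 2 1. With [b0 = 0], the term ['X^1 * w] is of degree below [n]. *)
    have b0E : b0 = 0%N.
      case: (posnP b0) => // b0P.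
      have b'0 := ok_32_b b_gt0 okl'; subst b'.
      have := ok_ab_gt0 okl'; rewrite addn0 => a'P.
      by case: (ok_32k1321 b0P c0P a'P okl).
    have {}XwP := XwP b0E.
    apply: (hnear _ _ _ _ _ n.+1 (- s) (- s) (- s) okl') => //; try by ldtac.
    + by right.
    + rewrite (_ : _ + _ = 'X^1 * ('X^1 * w) + ('X^1 * y + geom 'X 1 * (x' + w'))).
        by ldtac.
      by rewrite /w' geomS geom0 expr0; ring.
  apply: (hneq _ _ _ _ _ (n + a)%N (- (2 * s)) s (- s) okl') => //; try by ldtac.
Qed.

Lemma alive_states l :
  [/\ alive_D l, alive_xy l, alive_x_neq_y l & alive_x_near_y l].
Proof.
elim: l => [|k l [hD hxy hneq hnear]].
  by rewrite /alive_D /alive_xy /alive_x_neq_y /alive_x_near_y; split;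
    intros; (eapply alive_nil; [|eassumption]; assumption).
by case: k => -[a b] c; split; [exact: alive_D_step | exact: alive_xy_step |
  exact: alive_x_neq_y_step | exact: alive_x_near_y_step].
Qed.

(** * The braids invisible to the plane y = 0 *)

(* T = sigma_2 sigma_1 sigma_3 sigma_2 exchanges sigma_1 and sigma_3 and
   preserves the plane y = 0, so the braids sigma_1^i sigma_3^j T^r are the ones
   that the vectors of this plane cannot detect. *)
Definition flip_word : seq 'I_3 := [:: i2; i1; i3; i2].

Definition monomial (g : B4) : Prop := exists i j r : nat,
  g = (sigma i1 ^+ i * sigma i3 ^+ j * word_braid flip_word ^+ r)%g.

Section Monomial.
Local Open Scope group_scope.
Local Notation T := (word_braid flip_word).

Lemma flip_wordE : T = sigma i2 * sigma i1 * sigma i3 * sigma i2.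
Proof. by rewrite !word_braid_cons word_braid_nil mulg1 !mulgA. Qed.

Lemma flip_word1 : T * sigma i1 = sigma i3 * T.
Proof.
rewrite flip_wordE -(mulgA (sigma i2)) sigma13.
transitivity (sigma i2 * sigma i3 * (sigma i1 * sigma i2 * sigma i1)).
  by rewrite !mulgA.
by rewrite sigma121 !mulgA sigma232 -(mulgA (sigma i3 * _)) -sigma13 !mulgA.
Qed.

Lemma flip_word3 : T * sigma i3 = sigma i1 * T.
Proof.
rewrite flip_wordE.
transitivity (sigma i2 * sigma i1 * (sigma i3 * sigma i2 * sigma i3)).
  by rewrite !mulgA.
by rewrite -sigma232 !mulgA -sigma121.
Qed.

Lemma monomial1 : monomial 1.
Proof. by exists 0%N, 0%N, 0%N; rewrite !mulg1. Qed.

Lemma monomial_sigma1 n g : monomial g -> monomial (sigma i1 ^+ n * g).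
Proof.
by case=> i [j [r ->]]; exists (n + i)%N, j, r; rewrite expgnDr !mulgA.
Qed.

Lemma monomial_sigma3 n g : monomial g -> monomial (sigma i3 ^+ n * g).
Proof.
case=> i [j [r ->]]; exists i, (n + j)%N, r; rewrite expgnDr !mulgA.
do 2!congr (_ * _).
apply/esym; apply: expg_intertwine; apply/esym/expg_intertwine.
exact/esym/sigma13.
Qed.

Lemma monomial_flip g : monomial g -> monomial (T * g).
Proof.
case=> i [j [r ->]]; exists j, i, r.+1; rewrite expgS !mulgA.
congr (_ * _); rewrite -(expg_intertwine i (esym flip_word1)).
rewrite -mulgA -(expg_intertwine j (esym flip_word3)) mulgA.
congr (_ * _); apply/esym; apply: expg_intertwine; apply/esym/expg_intertwine.
exact/esym/sigma13.
Qed.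
End Monomial.

(** * The first syllables, applied to the outer basis vectors *)

Local Notation e1 := (1 : {poly int}, 0 : {poly int}, 0 : {poly int}).
(** In the stored coordinates this is the last basis vector times the unit [- 1 / q]. *)
Local Notation e3 := (0 : {poly int}, 0 : {poly int}, 1 : {poly int}).

Lemma detects_scale n v u : detects v u -> detects (scale3 'X^n v) u.
Proof.
case=> m [s [sP yP]]; exists (m + n)%N, s; split => //.
rewrite run_scale; case: (run _ _ _) yP => -[x y] w /= yP; ldtac.
Qed.

Lemma detects_scaleN v u : detects v u -> detects (scale3 (- 1) v) u.
Proof.
case=> m [s [sP yP]]; exists m, (- s); split; first exact: goodN.
rewrite run_scale; case: (run _ _ _) yP => -[x y] w /= yP.
by rewrite mulN1r; apply: ldN.
Qed.

(** sigma_1^a sigma_3^b only multiplies [e1] by ['X^a], which is harmless for detection. *)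
Lemma alive_e1_plane a b c l : alive e1 ((0, 0, c)%N :: l) -> alive e1 ((a, b, c) :: l).
Proof.
rewrite /alive !syl_word_cons => h; rewrite catA /detects run_cat.
have -> : run 'X e1 (nseq a i1 ++ nseq b i3) = scale3 'X^a e1.
  rewrite (_ : _ ++ _ = syl_word [:: (a, b, 0%N)]); last by rewrite /syl_word /= !cats0.
  by rewrite run_block /block /= geom0; congr (_, _, _); ring.
exact: detects_scale.
Qed.

Lemma alive_e3_plane a b c l : alive e3 ((0, 0, c)%N :: l) -> alive e3 ((a, b, c) :: l).
Proof.
rewrite /alive !syl_word_cons => h; rewrite catA /detects run_cat.
have -> : run 'X e3 (nseq a i1 ++ nseq b i3) = scale3 'X^b e3.
  rewrite (_ : _ ++ _ = syl_word [:: (a, b, 0%N)]); last by rewrite /syl_word /= !cats0.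
  by rewrite run_block /block /= geom0; congr (_, _, _); ring.
exact: detects_scale.
Qed.

(** T maps [e1] to [- 'X] times [e3]. *)
Lemma detects_flip_e1 u : detects e3 u -> detects e1 (flip_word ++ u).
Proof.
move=> /(detects_scale 1)/detects_scaleN; rewrite /detects run_cat.
rewrite (_ : run _ e1 _ = scale3 (- 1) (scale3 'X^1 e3)) //=.
by congr (_, _, _); ring.
Qed.

Lemma detects_flip_e3 u : detects e1 u -> detects e3 (flip_word ++ u).
Proof.
move=> /(detects_scale 1)/detects_scaleN; rewrite /detects run_cat.
rewrite (_ : run _ e3 _ = scale3 (- 1) (scale3 'X^1 e1)) //=.
by congr (_, _, _); ring.
Qed.

(** Removing the prefix 1 3 2 leaves one sigma_2, which becomes the syllable [(0, 0, 1)]. *)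
Lemma ok_132 l : ok ((1, 1, 2)%N :: l) -> ok ((0, 0, 1)%N :: l).
Proof.
case=> lP [r1 r2] nP; split.
- exact: (@lexmin_suffix [:: i1; i3; i2] _ lP).
- split; case=> [|p] // pl; first exact: (r1 p.+1 pl).
  exact: (r2 p.+1 pl).
- rewrite /normal_cond; cbv zeta; case=> [|p] pl; first by split.
  have [h1 h2 h3 h4] := nP p.+1 pl; split=> // _ a0 b1.
  case: p pl h1 h2 h3 h4 a0 b1 => [|p] pl h1 h2 h3 h4 a0 b1; last exact: h2.
  (* The new first syllable has [a = 0] and [c = 1], so the second clause asks for an exponent above
     1 in the next one; the first clause supplies it. *)
  have [c1 c2] := h1 a0 b1; have := r2 1%N pl.
  by move: c1 c2; rewrite /syl_c /syl_a /=; lia.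
Qed.

(* sigma_2 maps e1 to (1, 1, 0) and e3 to (0, 1, 1); with y = 1, sigma_1^n takes
   x = 0 to from0 n and x = 1 to from1 n, and likewise for sigma_3^n and w. *)
Definition from0 n : {poly int} := - ('X^1 * geom 'X n).
Definition from1 n : {poly int} := 'X^n - 'X^1 * geom 'X n.

Lemma ld_from0 n : (0 < n)%N -> ld (from0 n) n (- 1).
Proof.
move=> n0; rewrite /from0 -[geom _ _]mulr1; ldtac.
Qed.
Lemma from1S n : from1 n.+1 = from0 n.
Proof. by rewrite /from1 /from0 geomS exprS; ring. Qed.
Lemma from1_0 : from1 0 = 1.
Proof. by rewrite /from1 geom0 mulr0 subr0. Qed.
Lemma from0_0 : from0 0 = 0.
Proof. by rewrite /from0 geom0 mulr0 oppr0. Qed.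
Lemma ld_from1 n m : (n <= m)%N -> (0 < m)%N -> ld (from1 n) m 0.
Proof.
case: n => [|[|n]] nm m0; first by rewrite from1_0; ldtac.
  by rewrite from1S from0_0; ldtac.
by rewrite from1S; have := ld_from0 (ltn0Sn n) => gP; ldtac.
Qed.

Lemma alive_e1_21a3b a b c l :
  alive (from1 a, 'X^c * 1 + geom 'X c * (from1 a + from0 b), from0 b) l ->
  alive e1 [:: (0, 0, 1)%N, (a, b, c) & l].
Proof.
move=> al; do 2!apply: alive_cons; move: al; congr alive.
rewrite /block /from1 /from0 [geom 'X 1]geomS !geom0; congr (_, _, _); try by ring.
Qed.

Lemma alive_e3_21a3b a b c l :
  alive (from0 a, 'X^c * 1 + geom 'X c * (from0 a + from1 b), from1 b) l ->
  alive e3 [:: (0, 0, 1)%N, (a, b, c) & l].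
Proof.
move=> al; do 2!apply: alive_cons; move: al; congr alive.
rewrite /block /from1 /from0 [geom 'X 1]geomS !geom0; congr (_, _, _); try by ring.
Qed.

(** Starting from [e1], the coordinate [w = from0 b] has degree [b] and dominates [x = from1 a]. *)
Lemma alive_start_b_ge_a a1 b1 a b c l : (a <= b)%N -> (1 < b)%N -> (0 < c)%N ->
  ok [:: (a1, b1, 1%N), (a, b, c) & l] -> alive e1 [:: (0, 0, 1)%N, (a, b, c) & l].
Proof.
move=> ab b1' c_gt0 okl; have okl' := ok_behead okl; apply: alive_e1_21a3b.
have [hD _ hneq _] := alive_states l.
have b_gt0 : (0 < b)%N by lia.
have hP := ld_from1 ab b_gt0; have gP := ld_from0 b_gt0.
case: c => [//|[|c]] in c_gt0 okl okl' *.
  apply: (hneq _ _ _ _ _ b (- 1) 1 (- 1) okl') => //; try by [ldtac | exact/goodN/good1 | exact: good1].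
apply: (hD _ _ _ _ _ _ (b + c.+1)%N (- 1) okl') => //; try by [ldtac | exact/goodN/good1].
- by move=> b0; rewrite b0 in b_gt0.
- by move=> b0; rewrite b0 in b_gt0.
Qed.

(** [e3] is the natural start, as [x = from0 a] then dominates; [e1] replaces it in the two cases
    where the leading terms do not suffice. *)
Lemma alive_start_a_gt_b a1 b1 a b c l : (b < a)%N -> (1 < a)%N -> (0 < c)%N ->
  ok [:: (a1, b1, 1%N), (a, b, c) & l] ->
  alive e1 [:: (0, 0, 1)%N, (a, b, c) & l] \/
  alive e3 [:: (0, 0, 1)%N, (a, b, c) & l].
Proof.
move=> ba a1' c_gt0 okl; have okl' := ok_behead okl.
have [hD hxy hneq hnear] := alive_states l.
have a_gt0 : (0 < a)%N by lia.
have gP := ld_from0 a_gt0; have hP := ld_from1 (ltnW ba) a_gt0.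
have gN1 := goodN good1.
case: c => [//|[|c]] in c_gt0 okl okl' *; last first.
  right; apply: alive_e3_21a3b.
  apply: (hD _ _ _ _ _ _ (a + c.+1)%N (- 1) okl') => //; try by ldtac.
  - by move=> b0; rewrite b0 from1_0; ldtac.
  - by move=> b0 _; rewrite b0 from1_0; exists a, (- 1); split => //; ldtac.
have [b0|b_gt0] := posnP b.
  subst b; clear hP.
  have [[l' [c' lE]]|lN] := pselect (exists l' c', l = (0, 1, c'.+1)%N :: l'); last first.
    right; apply: alive_e3_21a3b; rewrite from1_0.
    apply: (hxy _ _ _ _ _ _ _ a (- 1) okl) => //; try by ldtac.
    by move=> c l' lE; case: lN; exists l', c.
  (* From [e3] one has [w = 1] and [m = 0], so the condition [ld w m 0] of [alive_xy] fails; from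
     [e1] the coordinate [w] vanishes. *)
  left; apply: alive_e1_21a3b; subst l; apply: alive_cons; rewrite block0b from0_0 /=.
  have okl2 := ok_behead okl'.
  case: a => [//|[//|a]] in ba a1' a_gt0 okl okl' gP *.
  rewrite from1S (_ : _ + geom 'X c'.+1 * _ = 'X^1 * 1 + from0 a.+1 - 'X^1 * (geom 'X c'.+1 * 1)); last first.
    by rewrite [geom 'X 1]geomS geom0 (exprn_geom _ c'.+1); ring.
  rewrite (_ : 'X^1 * 0 - _ = - ('X^1 * ('X^1 * 1 + from0 a.+1))); last first.
    by rewrite [geom 'X 1]geomS geom0; ring.
  have ga := ld_from0 (ltn0Sn a).
  case: l' => [|[[a' b'] c''] l'] in okl okl' okl2 hD hxy hneq hnear *.
    case: (ltngtP c' a) => ca.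
    - apply: (@alive_nil _ _ _ a.+1 (- 1)) => //; ldtac.
    - apply: (@alive_nil _ _ _ c'.+1 (- 1)) => //; ldtac.
    - subst c'; have [aE|a_gt0'] := posnP a.
        by subst a; apply: (@alive_nil _ _ _ 1%N (- 1)) => //; ldtac.
      by apply: (@alive_nil _ _ _ a.+1 (- (2 * 1))); [exact/goodN/good2/good1 | ldtac].
  have ac := ok_1_01c okl'.
  have [hD' _ _ _] := alive_states ((a', b', c'') :: l').
  apply: (hD' _ _ _ _ _ _ c'.+1 (- 1) okl2) => //; try by ldtac.
have [a3|a2] := ltnP 2 a.
  right; apply: alive_e3_21a3b.
  have hP' : ld (from1 b) a.-1 0 by apply: ld_from1; lia.
  apply: (hnear _ _ _ _ _ a (- 1) (- 1) 0 okl') => //; try by ldtac.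
  - by left.
  - rewrite (_ : _ + _ = 'X^2 * 1 + 'X^1 * from1 b + ('X^1 * 1 + geom 'X 1 * (from0 a + from1 b))).
      by ldtac.
    by rewrite geomS geom0; ring.
(* Only [a = 2], [b = 1] remains. There [e3] gives ['X^1 * (y - x) + y = 0], while [e1] gives
   [x = y]. *)
left; apply: alive_e1_21a3b.
have aE : a = 2 by lia. have bE : b = 1%N by lia.
subst a b; rewrite from1S; have g1P := ld_from0 (ltn0Sn 0).
rewrite (_ : 'X^1 * 1 + _ = from0 1%N); last by rewrite /from0 geomS geom0 expr0; ring.
apply: (hnear _ _ _ _ _ 1%N (- 1) (- 1) (- 1) okl') => //; first by left.
by rewrite subrr mulr0 add0r; ldtac.
Qed.

(** Induction on the number of syllables. When the word after sigma_1^a1 sigma_3^b1 begins with T in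
    the case [c <= 2], that T is removed and the roles of [e1] and [e3] are exchanged. *)
Lemma alive_start l : ok l ->
  [\/ monomial (word_braid (syl_word l)), alive e1 l | alive e3 l].
Proof.
have [n] := ubnP (size l); elim: n l => [//|n IH] [|[[a1 b1] c1] l] sz okl.
  by constructor 1; rewrite word_braid_nil; exact: monomial1.
have mono2 u : monomial (word_braid u) -> monomial (word_braid (nseq a1 i1 ++ nseq b1 i3 ++ u)).
  rewrite !word_braid_cat !word_braid_nseq.
  by move/(monomial_sigma3 b1)/(monomial_sigma1 a1).
have [hD _ _ _] := alive_states l.
case: c1 => [|[|c]] in sz okl *; last first.
- constructor 2; apply/alive_e1_plane/alive_cons.
  rewrite block0b /= (_ : _ + _ = geom 'X c.+2 * 1); last by ring.
  rewrite (_ : _ - _ = 0); last by ring.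
  apply: (hD _ _ _ _ _ _ c.+1 1 okl) => //; try by [ldtac | exact: good1 | move=> _; ldtac].
  by move=> _ _; exists 0%N, 1; split; [exact: good1 | rewrite mulr0 addr0; ldtac].
- case: l => [|[[a b] c] l] in sz okl hD *.
    constructor 2; apply/alive_e1_plane/alive_cons.
    apply: (@alive_nil _ _ _ 0%N 1); first exact: good1.
    by rewrite geom0 geomS geom0 (_ : _ + _ = 1); [ldtac | ring].
  have okl' := ok_behead okl; have abP := ok_ab_gt0 okl.
  have [cz|c_gt0] := posnP c.
    case: l okl okl' sz hD => [|[[a' b'] c'] l] okl okl' _ _; last first.
      by move: okl'; rewrite cz => /ok_c_gt0.
    constructor 2; apply/alive_e1_plane/alive_e1_21a3b; rewrite cz.
    apply: (@alive_nil _ _ _ 0%N 1); first exact: good1.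
    by rewrite geom0 mul0r addr0 mul1r; ldtac.
  have [hD' _ _ _] := alive_states l.
  have [M1|M1] := leqP (maxn a b) 1; last first.
    have [ab|ba] := leqP a b.
      by constructor 2; apply/alive_e1_plane/(alive_start_b_ge_a _ _ _ okl); lia.
    case: (alive_start_a_gt_b _ _ _ okl) => [||| al|al]; try lia.
      by constructor 2; apply: alive_e1_plane.
    by constructor 3; apply: alive_e3_plane.
  have bE : b = 1%N.
    have [bE|bE] := posnP b; last by lia.
    have aE : a = 1%N by lia.
    by case: (@ok_not_212 a1 b1 1 c l) => //; rewrite aE bE in okl.
  subst b; have [aE|a_gt0] := posnP a.
    subst a; constructor 3; apply/alive_e3_plane/alive_e3_21a3b.
    rewrite from0_0 from1S (_ : from0 0 = 0) ?from0_0 // addr0 mulr0 addr0.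
    apply: (hD' _ _ _ _ _ _ c 1 okl') => //; try by [ldtac | exact: good1 | move=> _; ldtac].
  have aE : a = 1%N by lia.
  subst a; case: c => [//|[|[|c]]] in sz okl okl' c_gt0 hD *.
  - have okl2 := ok_behead okl'.
    have wE : syl_word [:: (a1, b1, 1%N), (1%N, 1%N, 1%N) & l] =
        nseq a1 i1 ++ nseq b1 i3 ++ flip_word ++ syl_word l.
      by rewrite syl_word_cons.
    have [|m|al|al] := IH l _ okl2; first by move: sz => /=; lia.
    + constructor 1; rewrite wE; apply: mono2.
      by rewrite word_braid_cat; exact: monomial_flip.
    + by constructor 3; apply: alive_e3_plane; exact: detects_flip_e3.
    + by constructor 2; apply: alive_e1_plane; exact: detects_flip_e1.
  (* T absorbs one of the two sigma_2; the other forms the syllable [(0, 0, 1)], and the list is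
     still one syllable shorter. *)
  - have okl2 := ok_132 okl'.
    have wE : syl_word [:: (a1, b1, 1%N), (1%N, 1%N, 2%N) & l] =
        nseq a1 i1 ++ nseq b1 i3 ++ flip_word ++ syl_word ((0, 0, 1)%N :: l).
      by rewrite syl_word_cons.
    have [|m|al|al] := IH ((0, 0, 1)%N :: l) _ okl2; first by move: sz => /=; lia.
    + constructor 1; rewrite wE; apply: mono2.
      by rewrite word_braid_cat; exact: monomial_flip.
    + by constructor 3; apply: alive_e3_plane; exact: detects_flip_e3.
    + by constructor 2; apply: alive_e1_plane; exact: detects_flip_e1.
  - constructor 3; apply/alive_e3_plane/alive_e3_21a3b.
    rewrite from1S from0_0 addr0 (_ : _ + _ = - ('X^1 * (geom 'X c.+2 * 1))); last first.
      by rewrite /from0 [geom 'X 1]geomS geom0 [geom 'X c.+3]geomS [in LHS]exprS; ring.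
    have gP := ld_from0 (ltn0Sn 0).
    apply: (hD' _ _ _ _ _ _ c.+2 (- 1) okl') => //; try by [ldtac | exact/goodN/good1].
- case: l {hD sz} okl => [|[[a b] c] l] okl; last by have := ok_c_gt0 okl.
  constructor 1; rewrite syl_word_cons; apply: mono2.
  by rewrite word_braid_nil; exact: monomial1.
Qed.

(** * Powers of Delta *)

Definition delta_word : seq 'I_3 := [:: i1; i2; i3; i1; i2; i1].

Lemma flatten_nseqS (T : Type) m (u : seq T) :
  flatten (nseq m.+1 u) = u ++ flatten (nseq m u).
Proof. by []. Qed.

Lemma Delta_word : Delta = word_braid delta_word.
Proof. by rewrite !word_braid_cons word_braid_nil mulg1 /Delta !mulgA. Qed.

Lemma word_braid_pow m u : word_braid (flatten (nseq m u)) = (word_braid u ^+ m)%g.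
Proof.
elim: m => [|m IH]; first by rewrite word_braid_nil.
by rewrite /= word_braid_cat IH expgS.
Qed.

Lemma Delta_flip : (sigma i1 * sigma i3 * word_braid flip_word = Delta)%g.
Proof.
rewrite flip_wordE Delta_word !word_braid_cons word_braid_nil mulg1 !mulgA.
rewrite -(mulgA (_ * _ * sigma i2)%g (sigma i1) (sigma i3)) [X in (_ * X * _)%g]sigma13.
transitivity (sigma i1 * (sigma i3 * sigma i2 * sigma i3) * (sigma i1 * sigma i2))%g.
  by rewrite !mulgA.
rewrite -sigma232.
transitivity (sigma i1 * sigma i2 * sigma i3 * (sigma i2 * sigma i1 * sigma i2))%g.
  by rewrite !mulgA.
by rewrite -sigma121 !mulgA.
Qed.

(** Delta = sigma_1 sigma_3 T, and T commutes with sigma_1 sigma_3 since it exchanges the two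
    commuting factors. *)
Lemma monomial_diag r :
  (sigma i1 ^+ r * sigma i3 ^+ r * word_braid flip_word ^+ r = Delta ^+ r)%g.
Proof.
have c13 : commute (sigma i1) (sigma i3) by exact: sigma13.
rewrite -expgMn // -expgMn ?Delta_flip //.
by rewrite /commute -mulgA -flip_word1 mulgA -flip_word3 -mulgA sigma13.
Qed.

(** * Specialization at a unit that is no root of a polynomial led by a signed power of 2 *)

Section Specialization.
Variables (K : comUnitRingType) (q : K).
Hypothesis qU : q \is a GRing.unit.
Hypothesis q_good : forall (P : {poly int}) n s, good s -> ld P n s ->
  (map_poly intr P).[q] != 0.

Let f : {rmorphism {poly int} -> K} := horner_eval q \o map_poly (intr : int -> K).

(** ['X^m - 'X^n] with [m < n] has leading coefficient -1, so [q] is not a root of it. *)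
Lemma qX_inj i j : q ^+ i = q ^+ j -> i = j.
Proof.
have h m n : (m < n)%N -> q ^+ m = q ^+ n -> False.
  move=> mn qmn; have ldP : ld ('X^m * 1 - 'X^n * 1) n (- 1) by ldtac.
  have := q_good (goodN good1) ldP.
  by rewrite !mulr1 rmorphB /= !map_polyXn hornerD hornerN !hornerXn qmn subrr eqxx.
by move=> qij; case: (ltngtP i j) => // ij; [case: (h i j) | case: (h j i)].
Qed.

Definition triple (r : 'rV[K]_3) : K * K * K :=
  (r ord0 i1, r ord0 i2, - q * r ord0 i3).

Lemma triple_act r i : triple (r *m burau_mx q i) = act q (triple r) i.
Proof.
have sum3 (F : 'I_3 -> K) : \sum_k F k = F i1 + F i2 + F i3.
  rewrite !big_ord_recl big_ord0 addr0 addrA.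
  by congr (F _ + F _ + F _); apply: val_inj.
rewrite /triple !mxE !sum3.
move: (r ord0 i1) (r ord0 i2) (r ord0 i3) => x y z.
by case: i => -[|[|[|//]]] ?; rewrite /burau_mx /= !mxE /=; congr (_, _, _); ring.
Qed.

Lemma triple_run r u :
  triple (r *m burau q (word_braid u)) = run q (triple r) u.
Proof.
elim: u r => [|i u IH] r; first by rewrite word_braid_nil gmulf1 mulmx1.
by rewrite word_braid_cons gmulfM GLmxM mulmxA IH burau_sigma // triple_act.
Qed.

Lemma det_burau u : \det (burau q (word_braid u)) = q ^+ size u.
Proof.
elim: u => [|i u IH]; first by rewrite word_braid_nil gmulf1 det1.
by rewrite word_braid_cons gmulfM GLmxM det_mulmx IH burau_sigma // det_burau_mx exprS.
Qed.

Lemma burau_run u u' v : burau q (word_braid u) = burau q (word_braid u') ->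
  run q v u = run q v u'.
Proof.
case: v => -[x y] w uu'.
have <- : triple (\row_j [:: x; y; - q^-1 * w]`_j) = (x, y, w).
  by rewrite /triple !mxE /= mulrA mulrNN divrr // mul1r.
by rewrite -!triple_run uu'.
Qed.

Lemma run_delta x y w :
  run q (x, y, w) delta_word = (- q ^+ 2 * w, - q ^+ 2 * y, - q ^+ 2 * x).
Proof. by rewrite /=; congr (_, _, _); ring. Qed.

Lemma run_delta_plane m x w :
  (run q (x, 0, w) (flatten (nseq m delta_word))).1.2 = 0.
Proof.
elim: m x w => [//|m IH] x w.
by rewrite flatten_nseqS run_cat run_delta mulr0 IH.
Qed.

Lemma run_delta_axis m y : exists y',
  run q (0, y, 0) (flatten (nseq m delta_word)) = (0, y', 0).
Proof.
elim: m y => [|m IH] y; first by exists y.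
by rewrite flatten_nseqS run_cat run_delta !mulr0; exact: IH.
Qed.

(* In these coordinates sigma_1 and sigma_3 act diagonally, by (q, 1, 1) and
   (1, 1, q), and T is antidiagonal. *)
Definition diag (v : K * K * K) : K * K * K :=
  let '(x, y, w) := v in ((q - 1) * x - q * y, y, (q - 1) * w - q * y).

Lemma diag_run1 n v A Y B : diag v = (A, Y, B) ->
  diag (run q v (nseq n i1)) = (q ^+ n * A, Y, B).
Proof.
elim: n v A Y B => [|n IH] [[x y] w] A Y B; first by rewrite expr0 mul1r.
case=> <- <- <-; rewrite exprSr -mulrA; apply: (IH (q * (x - y), y, w)) => /=.
by congr (_, _, _); ring.
Qed.

Lemma diag_run3 n v A Y B : diag v = (A, Y, B) ->
  diag (run q v (nseq n i3)) = (A, Y, q ^+ n * B).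
Proof.
elim: n v A Y B => [|n IH] [[x y] w] A Y B; first by rewrite expr0 mul1r.
case=> <- <- <-; rewrite exprSr -mulrA; apply: (IH (x, y, q * (w - y))) => /=.
by congr (_, _, _); ring.
Qed.

Lemma diag_run_flip n v A Y B : diag v = (A, Y, B) ->
  diag (run q v (flatten (nseq n flip_word))) =
  if odd n then ((- q) ^+ n * B, (- q ^+ 2) ^+ n * Y, (- q) ^+ n * A)
  else ((- q) ^+ n * A, (- q ^+ 2) ^+ n * Y, (- q) ^+ n * B).
Proof.
elim: n v A Y B => [|n IH] [[x y] w] A Y B; first by rewrite !expr0 !mul1r.
case=> <- <- <-; rewrite flatten_nseqS run_cat.
rewrite (IH _ (- q * ((q - 1) * w - q * y)) (- q ^+ 2 * y) (- q * ((q - 1) * x - q * y))).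
  by rewrite /=; case: (odd n); rewrite !exprSr !mulrA.
by rewrite /=; congr (_, _, _); ring.
Qed.

(** In the diagonal coordinates, vectors on the middle axis are those whose outer entries are [- q]
    times the middle one. Comparing entries of the image gives [q ^+ i = q ^+ r = q ^+ j]. *)
Lemma monomial_axis i j r y' :
  run q (0, 1, 0) (nseq i i1 ++ nseq j i3 ++ flatten (nseq r flip_word)) = (0, y', 0) ->
  i = r /\ j = r.
Proof.
have d0 : diag (0, 1, 0) = (- q, 1, - q) by rewrite /diag !mulr0 mulr1 !sub0r.
rewrite !run_cat => E.
have := diag_run_flip r (diag_run3 j (diag_run1 i d0)); rewrite E /diag !mulr0 !sub0r mulr1.
have cancel n : (- q) ^+ r * (q ^+ n * - q) = - (q * (- q ^+ 2) ^+ r) -> n = r.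
  rewrite (_ : - q ^+ 2 = (- q) * q); last by ring.
  have AU : - q * (- q) ^+ r \is a GRing.unit by rewrite unitrM unitrX ?unitrN ?qU.
  rewrite exprMn; move: ((- q) ^+ r) AU => A AU eqn.
  apply/qX_inj/(mulrI AU); move: (q ^+ n) (q ^+ r) eqn => B C eqn.
  by transitivity (A * (B * - q)); [ring | rewrite eqn; ring].
by case: (odd r) => -[h1 h2 h3]; split; apply: cancel; rewrite -h2 -?h1 -?h3.
Qed.

Lemma horner_alive v l x y w : v = (x, y, w) -> alive v l ->
  (run q (f x, f y, f w) (syl_word l)).1.2 != 0.
Proof.
move=> -> [n [s [sP]]]; have := run_map f 'X x y w (syl_word l).
case: (run _ _ _) => -[x' y'] w'.
rewrite (_ : f 'X = q); last by rewrite /= map_polyX horner_evalE hornerX.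
by move=> -> /= /(q_good sP).
Qed.

Lemma burau_garside_neq1 g k s : g <> 1%g -> garside_nf g k s ->
  (0 <= k) \/ normal_braid s -> burau q g <> 1%g.
Proof.
move=> g1 [gE [u uE] sD] k_normal bg1.
(* The determinant [q ^+ size v] is 1 only for the empty word. *)
have det1 v : burau q (word_braid v) = 1%g -> v = [::].
  move=> bv1; apply/nilP/eqP/qX_inj; rewrite -det_burau bv1.
  exact: det1.
case: k gE k_normal => [m|m] gE k_normal.
  have gw : g = word_braid (flatten (nseq m delta_word) ++ u).
    by rewrite word_braid_cat word_braid_pow -Delta_word gE uE.
  by apply: g1; move: bg1; rewrite gw => /det1 ->; exact: word_braid_nil.
(* [Negz m] is [- (m + 1)], whence the power [m.+1] of Delta below. *)
case: k_normal => // -[l [[sl lmin] lred lnorm]].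
have sw : s = word_braid (syl_word l) by [].
have bs : burau q (word_braid (syl_word l)) =
    burau q (word_braid (flatten (nseq m.+1 delta_word))).
  rewrite -sw word_braid_pow -Delta_word.
  have -> : s = (Delta ^+ m.+1 * g)%g by rewrite gE mulVKg.
  by rewrite gmulfM /= bg1 mulg1.
have okl : ok l by split => // u' uu'; apply: lmin; exact: etrans sw uu'.
have [[i [j [r sm]]]|al|al] := alive_start okl.
- have sm' : word_braid (syl_word l) =
      word_braid (nseq i i1 ++ nseq j i3 ++ flatten (nseq r flip_word)).
    by rewrite sm !word_braid_cat !word_braid_nseq word_braid_pow mulgA.
  have bs' := bs; rewrite sm' in bs'.
  have [y' ey'] := run_delta_axis m.+1 1.
  have := @burau_run _ _ (0, 1, 0) bs'; rewrite ey'.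
  move=> /monomial_axis[ir jr]; subst i j.
  (* For [r = 0] the braid [s] is trivial, so the nonempty word of Delta^(m+1) would have the
     identity matrix; for [r > 0], Delta divides [s] on the left. *)
  case: r => [|r] in sm sm' bs bs' *.
    suff /det1 : burau q (word_braid (flatten (nseq m.+1 delta_word))) = 1%g by [].
    by rewrite -bs' word_braid_nil gmulf1.
  apply: (sD (Delta ^+ r)%g); last by rewrite sw sm monomial_diag expgS.
  by exists (flatten (nseq r delta_word)); rewrite /expansion -/(word_braid _) word_braid_pow Delta_word.
- have := horner_alive erefl al; rewrite rmorph1 rmorph0.
  by rewrite (burau_run _ bs) run_delta_plane eqxx.
- have := horner_alive erefl al; rewrite rmorph1 rmorph0.
  by rewrite (burau_run _ bs) run_delta_plane eqxx.
Qed.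
End Specialization.

(** * Admissible values of [q] *)

Lemma good_intr_neq0 (R : idomainType) s : 2 != 0 :> R -> good s -> s%:~R != 0 :> R.
Proof.
by move=> R2 [k [->|->]]; rewrite ?rmorphN rmorphXn ?oppr_eq0 expf_neq0.
Qed.

(** Evaluating at [laurentq R] embeds the polynomials over [R] into their fraction field, so one
    nonzero coefficient suffices. *)
Lemma laurentq_good (R : idomainType) (P : {poly int}) n s : 2 != 0 :> R ->
  good s -> ld P n s -> (map_poly intr P).[laurentq R] != 0.
Proof.
move=> R2 sP [_ Pn].
have PR0 : map_poly intr P != 0 :> {poly R}.
  apply/eqP => /(congr1 (fun p : {poly R} => p`_n)).
  by rewrite coef_map Pn coef0; apply/eqP/good_intr_neq0.
apply: contraNneq PR0 => /(congr1 val); rewrite rmorph0.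
set tofrac := @FracField.tofrac {poly R}.
rewrite -horner_map -map_poly_comp /=.
have -> : map_poly (@laurent_val R \o intr) P = map_poly (tofrac \o polyC) (map_poly intr P).
  rewrite -map_poly_comp; apply: eq_map_poly => i /=.
  by rewrite -[laurent_val _]/(val _) !rmorph_int.
rewrite map_poly_comp horner_map -/(_ \Po _) comp_polyXr => /eqP.
by rewrite tofrac_eq0.
Qed.

(** After clearing denominators, a root [a / b] would make [p] divide [s * a ^+ n], every other term
    containing a factor [b]. But [p] divides neither [a], coprime to [b], nor a power of 2. *)
Lemma rat_good (a b : int) (p : nat) (P : {poly int}) n s :
  prime p -> p <> 2 -> (p%:Z %| b)%Z -> coprimez a b -> b <> 0 ->
  good s -> ld P n s -> (map_poly intr P).[a%:Q / b%:Q] != 0.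
Proof.
move=> p_pr p2 pb ab b0 sP [szP Pn].
pose N := \sum_(i < n.+1) P`_i * a ^+ i * b ^+ (n - i).
have bQ : b%:Q != 0 by rewrite intr_eq0; apply/eqP.
have NE : N%:~R = (map_poly intr P).[a%:Q / b%:Q] * b%:Q ^+ n.
  rewrite (@horner_coef_wide _ n.+1); last first.
    exact: leq_trans (size_poly _ _) szP.
  rewrite rmorph_sum mulr_suml; apply: eq_bigr => i _.
  rewrite !rmorphM !rmorphXn /= coef_map /= expr_div_n -!mulrA; congr (_ * (_ * _)).
  have -> : b%:Q ^+ n = b%:Q ^+ (n - i) * b%:Q ^+ i.
    by rewrite -exprD subnK // -ltnS.
  by rewrite mulrC mulfK // expf_neq0.
apply/eqP => P0; rewrite P0 mul0r in NE.
have /eqP N0 : N == 0 by rewrite -(intr_eq0 rat) NE.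
have pN : (p%:Z %| s * a ^+ n)%Z.
  have -> : s * a ^+ n = - (\sum_(i < n) P`_i * a ^+ i * b ^+ (n - i)).
    apply/eqP; rewrite -addr_eq0 addrC -[X in _ == X]N0 /N big_ord_recr /=.
    by rewrite Pn subnn expr0 mulr1.
  rewrite rpredN; apply: rpred_sum => i _; apply: dvdz_mull.
  by rewrite -(subnSK (ltn_ord i)) exprS; apply: dvdz_mulr.
have pa : ~~ (p %| `|a|)%N.
  apply/negP => pa; move: ab; rewrite /coprimez /gcdz => /eqP[ab].
  have : (p %| gcdn `|a| `|b|)%N by move: pb; rewrite dvdzE /= dvdn_gcd pa.
  by rewrite ab dvdn1 => /eqP p1; rewrite p1 in p_pr.
have sE : exists k, `|s|%N = (2 ^ k)%N.
  by case: sP => k [->|->]; exists k; rewrite ?abszN abszX.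
move: pN; rewrite dvdzE abszM abszX /= Euclid_dvdM // !Euclid_dvdX // (negPf pa) /= orbF.
case: sE => k' ->; rewrite Euclid_dvdX // => /andP[+ _].
by rewrite dvdn_prime2 // => /eqP.
Qed.

Local Close Scope ring_scope.

Theorem theorem1p5 (g : B4) (k : int) (s : B4) (t : nat) (a b : int) :
  g <> 1%g ->
  garside_nf g k s ->
  prime t -> t <> 2 ->
  coprimez a b ->
  b <> 0%R ->
  (exists p : nat, [/\ prime p, p <> 2 & (p%:Z %| b)%Z]) ->
  ((0 <= k)%R \/ normal_braid s -> beta4_mod t g <> 1%g /\ beta4 g <> 1%g) /\
  (normal_braid s -> beta4_at (a%:Q / b%:Q)%R g <> 1%g).
Proof.
move=> g1 gP t_pr t2 ab b0 [p [p_pr p2 pb]]; split=> [ks | sN].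
  split.
    apply: (burau_garside_neq1 (laurentq_unit _) _ g1 gP ks) => P n c.
    apply: laurentq_good; rewrite -(dvdn_pcharf (pchar_Fp t_pr)).
    by rewrite dvdn_prime2 //; apply/eqP.
  apply: (burau_garside_neq1 (laurentq_unit _) _ g1 gP ks) => P n c.
  exact: laurentq_good.
apply: (burau_garside_neq1 _ _ g1 gP (or_intror sN)) => [|P n c].
  rewrite unitfE mulf_eq0 invr_eq0 !intr_eq0 negb_or; apply/andP; split; last exact/eqP.
  (* If [a = 0], coprimality forces [b] to be 1 or -1, which has no prime factor. *)
  apply/eqP => a0; move: ab pb; rewrite a0 /coprimez gcd0z => /eqP[b1].
  rewrite dvdzE /= b1 dvdn1 => /eqP p1.
  by rewrite p1 in p_pr.
exact: (rat_good p_pr p2 pb ab b0).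
Qed.
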